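(* Let $(M,g,\circ,e,\mathcal{E},\kappa)$ be a non-trivial, semi-simple CDV-structure, let $h=g(\cdot,\kappa\,\cdot)$, and write $h=\hat g-i\hat\omega$ with $\hat g$ a real pseudo-Riemannian metric and $\hat\omega$ a real $(1,1)$-form on $M_{\mathbb{R}}$. Let $\nabla$ be the Levi-Civita connection of $g$, $D'$ the $(1,0)$-part of the Chern connection of $h$, and $\hat\nabla$ the Levi-Civita connection of $\hat g$. Then: (1) $\hat\omega$ is not a symplectic form on $M_{\mathbb{R}}$, i.e. $d\hat\omega\neq0$. Moreover, if $(M,g,\circ,e,\mathcal{E},\kappa)$ is a CDV$\oplus$-structure, then the underlying Hermitian manifold $(M,h)$ is not a Kähler manifold. (2) The three connections $\nabla,D',\hat\nabla$ are pairwise distinct (after the identification of $\mathcal{T}_M^{(1,0)}$ with $T_{M_{\mathbb{R}}}$ via $\mathcal{R}e$).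
   Context: Frobenius manifold. $M$ is a complex analytic manifold of dimension $m$, $\Theta_M$ is its sheaf of holomorphic vector fields; $g$ is a holomorphic symmetric non-degenerate bilinear form on $\Theta_M$ with Levi-Civita connection $\nabla$; $\circ$ is a holomorphic commutative associative product on $\Theta_M$ with unit field $e$; $\mathcal{E}$ is a holomorphic vector field (Euler field). These satisfy: $\nabla$ is flat; $g(X\circ Y,Z)=g(X,Y\circ Z)$; $\nabla e=0$; with $c(X,Y,Z):=g(X\circ Y,Z)$ the tensor $(\nabla_Zc)(U,V,W)$ is symmetric in its four arguments; $\nabla(\nabla\mathcal{E})=0$, $\mathcal{L}_{\mathcal{E}}(\circ)=\circ$, and $\mathcal{L}_{\mathcal{E}}(g)=(2-d)g$ for some constant $d$. It is semi-simple if near every point there are holomorphic coordinates $(u^1,\dots,u^m)$, called canonical, with $\partial_{u^\alpha}\circ\partial_{u^\beta}=\delta_{\alpha\beta}\partial_{u^\alpha}$. Coordinates $(t^i)$ are $\nabla$-flat if $\nabla\partial_{t^i}=0$ for all $i$. Locally, in flat coordinates $(t^i)$, there is a potential function $F$ with $\partial^3F/\partial t^i\partial t^j\partial t^k=g(\partial_{t^i}\circ\partial_{t^j},\partial_{t^k})$. The Frobenius manifold is trivial if, locally, the potential function is a polynomial of degree three when expressed in some holomorphic $\nabla$-flat local coordinates. A CDV-structure is non-trivial (semi-simple) if the underlying Frobenius manifold is non-trivial (semi-simple). $\mathcal{T}_M^{(1,0)}$ is the $C^\infty$ complex vector bundle underlying the holomorphic tangent bundle, with its operator $\overline\partial$;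 $g$, $\circ$ are extended $C^\infty$-linearly and $\nabla$ is extended to a $(1,0)$-connection on $\mathcal{T}_M^{(1,0)}$. The Chern connection $D_h=D'+\overline\partial$ of a Hermitian pseudo-metric $h$ is the unique connection with $(0,1)$-part $\overline\partial$ and $D_h(h)=0$. CDV-structure. Given a Frobenius manifold and a smooth fiberwise $\mathbb{C}$-anti-linear involution $\kappa$ of $\mathcal{T}_M^{(1,0)}$, put $h:=g(\cdot,\kappa\,\cdot)$, $D:=D_h$ with $(1,0)$-part $D'$ and $(0,1)$-part $D''=\overline\partial$, $C_XY:=-X\circ Y$, $\tilde C:=\kappa C\kappa$ (i.e. $\tilde C_{\overline X}=\kappa C_X\kappa$), $\mathcal{U}:=\mathcal{E}\circ$, $\mathcal{Q}:=D_{\mathcal{E}}-\mathcal{L}_{\mathcal{E}}-\frac{2-d}{2}\mathrm{Id}$. One says $(M,g,\circ,e,\mathcal{E},\kappa)$ is a CDV-structure if $d\in\mathbb{R}$, $D_ee=0$, and $(\mathcal{T}_M^{(1,0)}\to M,D,C,\tilde C,\kappa,h,\mathcal{U},\mathcal{Q})$ is a CV-structure, i.e.: (1) $(C+D'')^2=0$, $(\tilde C+D')^2=0$, $D'(C)=0$, $D''(\tilde C)=0$, $D'D''+D''D'=-(C\tilde C+\tilde CC)$; (2) $\kappa^2=\mathrm{Id}$, $D(\kappa)=0$ (i.e. $D'_X\kappa=\kappa D''_{\overline X}$ and $D''_{\overline X}\kappa=\kappa D'_X$), $\kappa C\kappa=\tilde C$; (3) $h$ is a Hermitian pseudo-metric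 (linear on the left, semi-linear on the right, non-degenerate, $h(b,a)=\overline{h(a,b)}$), real-valued on $\ker(\kappa-\mathrm{Id})$, with $h(C_Xa,b)=h(a,\tilde C_{\overline X}b)$ and $D(h)=0$; (4) $[C,\mathcal{U}]=0$, $D'(\mathcal{U})-[C,\mathcal{Q}]+C=0$, $D''(\mathcal{U})=0$, $D'(\mathcal{Q})+[C,\kappa\mathcal{U}\kappa]=0$, $\kappa\mathcal{Q}\kappa+\mathcal{Q}=0$, $h(\mathcal{U}a,b)=h(a,\kappa\mathcal{U}\kappa b)$, $h(\mathcal{Q}a,b)=h(a,\mathcal{Q}b)$. It is a CDV$\oplus$-structure if in addition $h$ is positive definite. Real identification. $M_{\mathbb{R}}$ is the real manifold underlying $M$, $J$ its complex structure. $\mathcal{R}e:(\mathcal{T}_M^{(1,0)},i)\to(T_{M_{\mathbb{R}}},J)$ is the isomorphism of complex bundles given in holomorphic coordinates $z^j=x^j+iy^j$ by $\partial_{z^j}\mapsto\partial_{x^j}$, $i\partial_{z^j}\mapsto\partial_{y^j}$. Through it $h$ is regarded as a form on $T_{M_{\mathbb{R}}}$ with real part $\hat g$ and imaginary part $-\hat\omega$. $(M_{\mathbb R},\hat\omega)$ is symplectic if $d\hat\omega=0$; $(M,h)$ is Kähler if $h$ is positive definite and $d\hat\omega=0$. A $(1,0)$-connection $\delta$ on $\mathcal{T}_M^{(1,0)}$ (such as $\nabla$ or $D'$) is said to coincide with $\hat\nabla$ via $\mathcal{R}e$ if $\mathcal{R}e(\delta_{X^{1,0}}V)=\hat\nabla_X\mathcal{R}e(V)$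 for every local holomorphic vector field $V$ and every real vector field $X$ with $(1,0)$-part $X^{1,0}$ (equivalently, the connection $\delta+\overline\partial$ corresponds to $\hat\nabla$ under $\mathcal{R}e$); otherwise they are distinct. *)

(* Defs.v *)
(* A complex manifold is a Hausdorff space with a maximal holomorphic atlas.  A
   tensor field is the family of its coordinate expressions in the charts of
   the atlas, subject to the usual transformation law; vectors of T^(1,0) are
   written as row vectors in the frame (d/dz^1, ..., d/dz^m) of the chart. *)
From HB Require Import structures.
From mathcomp Require Import all_boot all_order all_algebra.
From mathcomp Require Import all_classical all_reals all_analysis.
From mathcomp Require Import complex.
Set Implicit Arguments.
Unset Strict Implicit.
Unset Printing Implicit Defensive.
Import Order.TTheory GRing.Theory Num.Theory.
Import numFieldNormedType.Exports.
Local Open Scope ring_scope.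
Local Open Scope complex_scope.
Local Open Scope classical_set_scope.

(* The usual topology of the complex numbers (not a default instance). *)
HB.instance Definition _ (R : realType) := NormedModule.copy R[i] R[i]^o.

Section Calculus.
Context {R : realType} {m : nat}.
Local Notation C := R[i].
Local Notation V := 'rV[C]_m.

(* Derivative at [x] of a real function on C^m along the real line through [x]
   directed by [w e_j]: d/dx^j for [w = 1], d/dy^j for [w = 'i]. *)
Definition line (w : C) (j : 'I_m) (x : V) (t : R) : V :=
  x + (t%:C * w) *: delta_mx 0 j.

Definition partial (w : C) (j : 'I_m) (f : V -> R) (x : V) : R :=
  derive1 (fun t : R => f (line w j x t)) 0.

Definition has_partial (w : C) (j : 'I_m) (f : V -> R) (x : V) : Prop :=
  derivable (fun t : R => f (line w j x t)) 0 1.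

Fixpoint Ck (k : nat) (U : set V) (f : V -> R) : Prop :=
  (forall x, U x -> {for x, continuous f}) /\
  match k with
  | 0 => True
  | k'.+1 => forall (j : 'I_m) (w : C), w = 1 \/ w = 'i%C ->
      (forall x, U x -> has_partial w j f x) /\ Ck k' U (partial w j f)
  end.

Definition rsmooth (U : set V) (f : V -> R) : Prop := forall k, Ck k U f.

Definition smooth (U : set V) (f : V -> C) : Prop :=
  rsmooth U (fun x => complex.Re (f x)) /\ rsmooth U (fun x => complex.Im (f x)).

Definition cpartial (w : C) (j : 'I_m) (f : V -> C) (x : V) : C :=
  partial w j (fun y => complex.Re (f y)) x +i*
  partial w j (fun y => complex.Im (f y)) x.

(* d/dz^j and d/d(conj z)^j *)
Definition dz (j : 'I_m) (f : V -> C) (x : V) : C :=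
  (cpartial 1 j f x - 'i%C * cpartial 'i%C j f x) / 2.

Definition dzbar (j : 'I_m) (f : V -> C) (x : V) : C :=
  (cpartial 1 j f x + 'i%C * cpartial 'i%C j f x) / 2.

(* Smooth and annihilated by dbar; equivalent to complex differentiability on an
   open set by Osgood's lemma and Cauchy's formula. *)
Definition holomorphic (U : set V) (f : V -> C) : Prop :=
  smooth U f /\ forall j x, U x -> dzbar j f x = 0.

(* The (1,0)-vector [u] and the conjugate of the (1,0)-vector [u], acting on
   functions. *)
Definition der (u : V) (f : V -> C) (x : V) : C := \sum_j u 0 j * dz j f x.

Definition derbar (u : V) (f : V -> C) (x : V) : C :=
  \sum_j (u 0 j)^*%C * dzbar j f x.

Definition smoothV (U : set V) (s : V -> V) : Prop :=
  forall k, smooth U (fun x => s x 0 k).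

Definition holomorphicV (U : set V) (s : V -> V) : Prop :=
  forall k, holomorphic U (fun x => s x 0 k).

Definition derV (u : V) (s : V -> V) (x : V) : V :=
  \row_k der u (fun y => s y 0 k) x.

Definition derbarV (u : V) (s : V -> V) (x : V) : V :=
  \row_k derbar u (fun y => s y 0 k) x.

(* For fields of type (1,0); also L_X Y when X is holomorphic and Y smooth. *)
Definition bracket (X Y : V -> V) (x : V) : V :=
  derV (X x) Y x - derV (Y x) X x.

(* The (1,0)-connection with connection form [G] in the coordinate frame. *)
Definition cov (G : V -> V -> V -> V) (X s : V -> V) (x : V) : V :=
  derV (X x) s x + G x (X x) (s x).

Definition bilin_field (W : lmodType C) (U : set V) (b : V -> V -> V -> W) :=
  forall x, U x -> (forall u, linear (b x u)) /\ (forall v, linear (b x ^~ v)).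

(* Real tangent vectors: [(a, b)] is \sum_j a_j d/dx^j + b_j d/dy^j. *)
Definition realvec : Type := ('rV[R]_m * 'rV[R]_m)%type.

(* The isomorphism T^(1,0) -> T M_R, and the (1,0)-part of a real vector; they
   are inverse to each other. *)
Definition toRe (u : V) : realvec :=
  (\row_j complex.Re (u 0 j), \row_j complex.Im (u 0 j)).

Definition part10 (X : realvec) : V := \row_j (X.1 0 j +i* X.2 0 j).

Definition rder (X : realvec) (f : V -> R) (x : V) : R :=
  \sum_j (X.1 0 j * partial 1 j f x + X.2 0 j * partial 'i%C j f x).

Definition rsmoothV (U : set V) (X : V -> realvec) : Prop :=
  forall k, rsmooth U (fun x => (X x).1 0 k) /\ rsmooth U (fun x => (X x).2 0 k).

Definition rderV (X : realvec) (Y : V -> realvec) (x : V) : realvec :=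
  (\row_k rder X (fun y => (Y y).1 0 k) x, \row_k rder X (fun y => (Y y).2 0 k) x).

Definition rbracket (X Y : V -> realvec) (x : V) : realvec :=
  rderV (X x) Y x - rderV (Y x) X x.

Definition rcov (G : V -> realvec -> realvec -> realvec)
    (X Y : V -> realvec) (x : V) : realvec :=
  rderV (X x) Y x + G x (X x) (Y x).

(* Cartan's formula for the exterior derivative. *)
Definition dform2 (w : V -> realvec -> realvec -> R)
    (X Y Z : V -> realvec) (x : V) : R :=
  rder (X x) (fun y => w y (Y y) (Z y)) x
  + rder (Y x) (fun y => w y (Z y) (X y)) x
  + rder (Z x) (fun y => w y (X y) (Y y)) x
  - w x (rbracket X Y x) (Z x)
  - w x (rbracket Y Z x) (X x)
  - w x (rbracket Z X x) (Y x).

End Calculus.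

Arguments realvec : clear implicits.

Section LocalStructures.
Context {R : realType} {m : nat}.
Local Notation C := R[i].
Local Notation V := 'rV[C]_m.

(* Torsion-free metric connections.  These conditions determine the connection
   form in each chart, so that the forms in two charts are automatically related
   by the transformation law of connections. *)
Record levi_civita (U : set V) (g : V -> V -> V -> C) (G : V -> V -> V -> V)
    : Prop := {
  lc_bilin : bilin_field U G;
  lc_hol : forall u v, holomorphicV U (fun x => G x u v);
  lc_torsion : forall X Y, holomorphicV U X -> holomorphicV U Y ->
    forall x, U x -> cov G X Y x - cov G Y X x = bracket X Y x;
  lc_metric : forall X Y Z,
    holomorphicV U X -> holomorphicV U Y -> holomorphicV U Z ->
    forall x, U x -> der (X x) (fun y => g y (Y y) (Z y)) x
      = g x (cov G X Y x) (Z x) + g x (Y x) (cov G X Z x) }.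

Record real_levi_civita (U : set V) (g : V -> realvec R m -> realvec R m -> R)
    (G : V -> realvec R m -> realvec R m -> realvec R m) : Prop := {
  rlc_bilin : forall x, U x ->
    (forall X, linear (G x X)) /\ (forall Y, linear (G x ^~ Y));
  rlc_smooth : forall X Y, rsmoothV U (fun x => G x X Y);
  rlc_torsion : forall X Y, rsmoothV U X -> rsmoothV U Y ->
    forall x, U x -> rcov G X Y x - rcov G Y X x = rbracket X Y x;
  rlc_metric : forall X Y Z, rsmoothV U X -> rsmoothV U Y -> rsmoothV U Z ->
    forall x, U x -> rder (X x) (fun y => g y (Y y) (Z y)) x
      = g x (rcov G X Y x) (Z x) + g x (Y x) (rcov G X Z x) }.

(* (nabla_Z c)(X, Y, W), where c(X, Y, W) = g(X o Y, W) *)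
Definition nabla_c (g : V -> V -> V -> C) (mul G : V -> V -> V -> V)
    (Z X Y W : V -> V) (x : V) : C :=
  der (Z x) (fun y => g y (mul y (X y) (Y y)) (W y)) x
  - g x (mul x (cov G Z X x) (Y x)) (W x)
  - g x (mul x (X x) (cov G Z Y x)) (W x)
  - g x (mul x (X x) (Y x)) (cov G Z W x).

Record local_frobenius (U : set V) (g : V -> V -> V -> C)
    (mul : V -> V -> V -> V) (e E : V -> V) (d : C) (G : V -> V -> V -> V)
    : Prop := {
  g_bilin : bilin_field (W := C^o) U g;
  g_hol : forall u v, holomorphic U (fun x => g x u v);
  g_sym : forall x u v, U x -> g x u v = g x v u;
  g_nondeg : forall x u, U x -> (forall v, g x u v = 0) -> u = 0;
  mul_bilin : bilin_field U mul;
  mul_hol : forall u v, holomorphicV U (fun x => mul x u v);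
  mul_comm : forall x u v, U x -> mul x u v = mul x v u;
  mul_assoc : forall x u v w, U x -> mul x (mul x u v) w = mul x u (mul x v w);
  e_hol : holomorphicV U e;
  mul_unit : forall x u, U x -> mul x (e x) u = u;
  E_hol : holomorphicV U E;
  nabla_lc : levi_civita U g G;
  nabla_flat : forall X Y Z,
    holomorphicV U X -> holomorphicV U Y -> holomorphicV U Z ->
    forall x, U x -> cov G X (cov G Y Z) x - cov G Y (cov G X Z) x
      - cov G (bracket X Y) Z x = 0;
  g_mul : forall x u v w, U x -> g x (mul x u v) w = g x u (mul x v w);
  nabla_e : forall X, holomorphicV U X -> forall x, U x -> cov G X e x = 0;
  nabla_c_sym : forall Z X Y W, holomorphicV U Z -> holomorphicV U X ->
    holomorphicV U Y -> holomorphicV U W -> forall x, U x ->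
    [/\ nabla_c g mul G Z X Y W x = nabla_c g mul G X Z Y W x,
        nabla_c g mul G Z X Y W x = nabla_c g mul G Z Y X W x &
        nabla_c g mul G Z X Y W x = nabla_c g mul G Z X W Y x];
  nabla_nabla_E : forall X Y, holomorphicV U X -> holomorphicV U Y ->
    forall x, U x -> cov G X (cov G Y E) x - cov G (cov G X Y) E x = 0;
  lie_E_mul : forall X Y, holomorphicV U X -> holomorphicV U Y ->
    forall x, U x -> bracket E (fun y => mul y (X y) (Y y)) x
      - mul x (bracket E X x) (Y x) - mul x (X x) (bracket E Y x)
      = mul x (X x) (Y x);
  lie_E_g : forall X Y, holomorphicV U X -> holomorphicV U Y ->
    forall x, U x -> der (E x) (fun y => g y (X y) (Y y)) x
      - g x (bracket E X x) (Y x) - g x (X x) (bracket E Y x)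
      = (2 - d) * g x (X x) (Y x) }.

(* Operators on smooth sections of T^(1,0), and one-forms with values in them.
   The pair [(u, v)] stands for the complexified tangent vector u + conj v.  Forms
   are evaluated on constant coordinate fields, whose brackets vanish. *)
Definition op := (V -> V) -> (V -> V).
Definition opform := V * V -> op.

Definition opadd (A B : opform) : opform := fun z s x => A z s x + B z s x.

Definition wedge (A B : opform) (z1 z2 : V * V) : op :=
  fun s x => A z1 (B z2 s) x - A z2 (B z1 s) x.

Definition conj_op (kappa : V -> V -> V) (A : op) : op :=
  fun s x => kappa x (A (fun y => kappa y (s y)) x).

Definition commop (A B : op) : op := fun s x => A (B s) x - B (A s) x.

Definition opC (mul : V -> V -> V -> V) (u : V) : op :=
  fun s x => - mul x u (s x).

Definition opU (mul : V -> V -> V -> V) (E : V -> V) : op :=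
  fun s x => mul x (E x) (s x).

Definition opQ (G : V -> V -> V -> V) (E : V -> V) (d : C) : op :=
  fun s x => cov G E s x - bracket E s x - ((2 - d) / 2) *: s x.

Definition opD' (G : V -> V -> V -> V) (u : V) : op := cov G (fun=> u).

Definition opD'' (u : V) : op := derbarV u.

Definition formC mul : opform := fun z => opC mul z.1.
Definition formCt kappa mul : opform := fun z => conj_op kappa (opC mul z.2).
Definition formD' G : opform := fun z => opD' G z.1.
Definition formD'' : opform := fun z => opD'' z.2.

Definition hermitian_form (g : V -> V -> V -> C) (kappa : V -> V -> V)
    (x u v : V) : C := g x u (kappa x v).

(* The (1,0)-part [G] of the Chern connection: D = D' + dbar and D(h) = 0. *)
Record chern (U : set V) (h : V -> V -> V -> C) (G : V -> V -> V -> V)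
    : Prop := {
  chern_bilin : bilin_field U G;
  chern_smooth : forall u v, smoothV U (fun x => G x u v);
  chern_h : forall u s t, smoothV U s -> smoothV U t -> forall x, U x ->
    der u (fun y => h y (s y) (t y)) x
    = h x (opD' G u s x) (t x) + h x (s x) (opD'' u t x);
  chern_hbar : forall u s t, smoothV U s -> smoothV U t -> forall x, U x ->
    derbar u (fun y => h y (s y) (t y)) x
    = h x (opD'' u s x) (t x) + h x (s x) (opD' G u t x) }.

Record hermitian_pseudo_metric (U : set V) (h : V -> V -> V -> C) : Prop := {
  h_linear : forall x v, U x -> linear (h x ^~ v : V -> C^o);
  h_semilinear : forall x u a v w, U x ->
    h x u (a *: v + w) = a^*%C * h x u v + h x u w;
  h_nondeg : forall x u, U x -> (forall v, h x u v = 0) -> u = 0;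
  h_herm : forall x u v, U x -> h x v u = (h x u v)^*%C }.

Record local_cv (U : set V) (g : V -> V -> V -> C) (mul : V -> V -> V -> V)
    (E : V -> V) (d : C) (kappa : V -> V -> V) (G : V -> V -> V -> V)
    : Prop := {
  cv_CD : forall z1 z2 s, smoothV U s -> forall x, U x ->
    wedge (opadd (formC mul) formD'') (opadd (formC mul) formD'') z1 z2 s x = 0;
  cv_CtD : forall z1 z2 s, smoothV U s -> forall x, U x ->
    wedge (opadd (formCt kappa mul) (formD' G))
          (opadd (formCt kappa mul) (formD' G)) z1 z2 s x = 0;
  cv_D'C : forall z1 z2 s, smoothV U s -> forall x, U x ->
    wedge (formD' G) (formC mul) z1 z2 s x
    + wedge (formC mul) (formD' G) z1 z2 s x = 0;
  cv_D''Ct : forall z1 z2 s, smoothV U s -> forall x, U x ->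
    wedge formD'' (formCt kappa mul) z1 z2 s x
    + wedge (formCt kappa mul) formD'' z1 z2 s x = 0;
  cv_curv : forall z1 z2 s, smoothV U s -> forall x, U x ->
    wedge (formD' G) formD'' z1 z2 s x + wedge formD'' (formD' G) z1 z2 s x
    = - (wedge (formC mul) (formCt kappa mul) z1 z2 s x
         + wedge (formCt kappa mul) (formC mul) z1 z2 s x);
  cv_kappaK : forall x u, U x -> kappa x (kappa x u) = u;
  cv_D'kappa : forall u s, smoothV U s -> forall x, U x ->
    opD' G u (fun y => kappa y (s y)) x = kappa x (opD'' u s x);
  cv_D''kappa : forall u s, smoothV U s -> forall x, U x ->
    opD'' u (fun y => kappa y (s y)) x = kappa x (opD' G u s x);
  cv_h : hermitian_pseudo_metric U (hermitian_form g kappa);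
  cv_h_real : forall x u v, U x -> kappa x u = u -> kappa x v = v ->
    hermitian_form g kappa x u v \is Num.real;
  cv_h_C : forall u s t, smoothV U s -> smoothV U t -> forall x, U x ->
    hermitian_form g kappa x (opC mul u s x) (t x)
    = hermitian_form g kappa x (s x) (conj_op kappa (opC mul u) t x);
  cv_chern : chern U (hermitian_form g kappa) G;
  cv_CU : forall u s, smoothV U s -> forall x, U x ->
    commop (opC mul u) (opU mul E) s x = 0;
  cv_D'U : forall u s, smoothV U s -> forall x, U x ->
    commop (opD' G u) (opU mul E) s x - commop (opC mul u) (opQ G E d) s x
    + opC mul u s x = 0;
  cv_D''U : forall u s, smoothV U s -> forall x, U x ->
    commop (opD'' u) (opU mul E) s x = 0;
  cv_D'Q : forall u s, smoothV U s -> forall x, U x ->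
    commop (opD' G u) (opQ G E d) s x
    + commop (opC mul u) (conj_op kappa (opU mul E)) s x = 0;
  cv_kappaQ : forall s, smoothV U s -> forall x, U x ->
    conj_op kappa (opQ G E d) s x + opQ G E d s x = 0;
  cv_h_U : forall s t, smoothV U s -> smoothV U t -> forall x, U x ->
    hermitian_form g kappa x (opU mul E s x) (t x)
    = hermitian_form g kappa x (s x) (conj_op kappa (opU mul E) t x);
  cv_h_Q : forall s t, smoothV U s -> smoothV U t -> forall x, U x ->
    hermitian_form g kappa x (opQ G E d s x) (t x)
    = hermitian_form g kappa x (s x) (opQ G E d t x) }.

Definition cubic_on (U : set V) (F : V -> C) : Prop :=
  exists (a0 : C) (a1 : 'I_m -> C) (a2 : 'I_m -> 'I_m -> C)
    (a3 : 'I_m -> 'I_m -> 'I_m -> C), forall x, U x ->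
  F x = a0 + \sum_i a1 i * x 0 i + \sum_i \sum_j a2 i j * x 0 i * x 0 j
        + \sum_i \sum_j \sum_k a3 i j k * x 0 i * x 0 j * x 0 k.

Definition potential (U : set V) (g : V -> V -> V -> C)
    (mul : V -> V -> V -> V) (F : V -> C) : Prop :=
  holomorphic U F /\ forall i j k x, U x ->
  dz i (dz j (dz k F)) x
  = g x (mul x (delta_mx 0 i) (delta_mx 0 j)) (delta_mx 0 k).

Definition flat_coordinates (U : set V) (G : V -> V -> V -> V) : Prop :=
  forall i X, holomorphicV U X ->
  forall x, U x -> cov G X (fun=> delta_mx 0 i) x = 0.

Definition canonical_coordinates (U : set V) (mul : V -> V -> V -> V) : Prop :=
  forall a b x, U x ->
  mul x (delta_mx 0 a) (delta_mx 0 b) = if a == b then delta_mx 0 a else 0.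

End LocalStructures.

Section Manifolds.
Context {R : realType} {m : nat} {M : topologicalType}.
Local Notation C := R[i].
Local Notation V := 'rV[C]_m.

(* The values of [to] outside [dom] and of [from] outside [img] are irrelevant. *)
Record chart := Chart { dom : set M; img : set V; to : M -> V; from : V -> M }.

Record is_chart (p : chart) : Prop := {
  dom_open : open (dom p);
  img_open : open (img p);
  to_img : forall q, dom p q -> img p (to p q);
  from_dom : forall x, img p x -> dom p (from p x);
  toK : forall q, dom p q -> from p (to p q) = q;
  fromK : forall x, img p x -> to p (from p x) = x;
  to_cont : forall q, dom p q -> {for q, continuous (to p)};
  from_cont : forall x, img p x -> {for x, continuous (from p)} }.

Definition transition (p q : chart) (x : V) : V := to q (from p x).

(* The part of the image of [p] that corresponds to [dom p `&` dom q]. *)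
Definition overlap (p q : chart) : set V := img p `&` from p @^-1` dom q.

Definition compatible (p q : chart) : Prop :=
  holomorphicV (overlap p q) (transition p q) /\
  holomorphicV (overlap q p) (transition q p).

(* The differential of [transition p q] at [x], on (1,0)-vectors. *)
Definition push (p q : chart) (x u : V) : V := derV u (transition p q) x.

End Manifolds.

Arguments chart : clear implicits.

Record complex_manifold (R : realType) (m : nat) (M : topologicalType) := {
  atlas : set (chart R m M);
  manifold_hausdorff : hausdorff_space M;
  atlas_chart : forall p, atlas p -> is_chart p;
  atlas_cover : forall q : M, exists2 p, atlas p & dom p q;
  atlas_compatible : forall p p', atlas p -> atlas p' -> compatible p p';
  atlas_maximal : forall p, is_chart p ->
    (forall p', atlas p' -> compatible p p') -> atlas p }.

(* The charts of the maximal atlas are all the local holomorphic coordinates. *)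
Record frobenius_manifold (R : realType) (m : nat) (M : topologicalType)
    (A : complex_manifold R m M) := {
  fm_g : chart R m M -> 'rV[R[i]]_m -> 'rV[R[i]]_m -> 'rV[R[i]]_m -> R[i];
  fm_mul : chart R m M ->
    'rV[R[i]]_m -> 'rV[R[i]]_m -> 'rV[R[i]]_m -> 'rV[R[i]]_m;
  fm_e : chart R m M -> 'rV[R[i]]_m -> 'rV[R[i]]_m;
  fm_E : chart R m M -> 'rV[R[i]]_m -> 'rV[R[i]]_m;
  fm_d : R[i];
  fm_nabla : chart R m M ->
    'rV[R[i]]_m -> 'rV[R[i]]_m -> 'rV[R[i]]_m -> 'rV[R[i]]_m;
  fm_transition : forall p q, atlas A p -> atlas A q ->
    forall x, overlap p q x ->
    [/\ forall u v, fm_g q (transition p q x) (push p q x u) (push p q x v)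
                    = fm_g p x u v,
        forall u v, fm_mul q (transition p q x) (push p q x u) (push p q x v)
                    = push p q x (fm_mul p x u v),
        fm_e q (transition p q x) = push p q x (fm_e p x) &
        fm_E q (transition p q x) = push p q x (fm_E p x)];
  fm_local : forall p, atlas A p -> local_frobenius (img p)
    (fm_g p) (fm_mul p) (fm_e p) (fm_E p) fm_d (fm_nabla p) }.

(* [cdv_D'] is the (1,0)-part of the Chern connection. *)
Record cdv_structure (R : realType) (m : nat) (M : topologicalType)
    (A : complex_manifold R m M) (F : frobenius_manifold A) := {
  cdv_kappa : chart R m M -> 'rV[R[i]]_m -> 'rV[R[i]]_m -> 'rV[R[i]]_m;
  cdv_D' : chart R m M ->
    'rV[R[i]]_m -> 'rV[R[i]]_m -> 'rV[R[i]]_m -> 'rV[R[i]]_m;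
  cdv_transition : forall p q, atlas A p -> atlas A q ->
    forall x, overlap p q x ->
    forall u, cdv_kappa q (transition p q x) (push p q x u)
              = push p q x (cdv_kappa p x u);
  cdv_semilinear : forall p, atlas A p -> forall x, img p x -> forall a u v,
    cdv_kappa p x (a *: u + v) = a^*%C *: cdv_kappa p x u + cdv_kappa p x v;
  cdv_smooth : forall p, atlas A p -> forall u,
    smoothV (img p) (fun x => cdv_kappa p x u);
  cdv_d_real : fm_d F \is Num.real;
  cdv_De_e : forall p, atlas A p -> forall x, img p x ->
    cov (cdv_D' p) (fm_e F p) (fm_e F p) x = 0;
  cdv_cv : forall p, atlas A p -> local_cv (img p)
    (fm_g F p) (fm_mul F p) (fm_E F p) (fm_d F) (cdv_kappa p) (cdv_D' p) }.

Section Notions.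
Context {R : realType} {m : nat} {M : topologicalType}.
Context {A : complex_manifold R m M}.
Local Notation C := R[i].
Local Notation V := 'rV[C]_m.

Definition semisimple (F : frobenius_manifold A) : Prop :=
  forall q : M, exists p : chart R m M,
    [/\ atlas A p, dom p q & canonical_coordinates (img p) (fm_mul F p)].

(* "Of degree three" is read as "of degree at most three".  In positive dimension
   the third derivatives of a potential cannot all vanish, because of the unit. *)
Definition trivial_frobenius (F : frobenius_manifold A) : Prop :=
  forall q : M, exists (p : chart R m M) (P : V -> C),
    [/\ atlas A p, dom p q, flat_coordinates (img p) (fm_nabla F p),
        potential (img p) (fm_g F p) (fm_mul F p) P & cubic_on (img p) P].

Context {F : frobenius_manifold A}.

Definition cdv_h (S : cdv_structure F) (p : chart R m M) : V -> V -> V -> C :=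
  hermitian_form (fm_g F p) (cdv_kappa S p).

(* h = ghat - i omegahat *)
Definition ghat (S : cdv_structure F) (p : chart R m M) (x : V)
    (X Y : realvec R m) : R := complex.Re (cdv_h S p x (part10 X) (part10 Y)).

Definition omegahat (S : cdv_structure F) (p : chart R m M) (x : V)
    (X Y : realvec R m) : R := - complex.Im (cdv_h S p x (part10 X) (part10 Y)).

Definition is_levi_civita_ghat (S : cdv_structure F) (nablahat : chart R m M ->
    V -> realvec R m -> realvec R m -> realvec R m) : Prop :=
  forall p, atlas A p -> real_levi_civita (img p) (ghat S p) (nablahat p).

(* Non-degeneracy of omegahat is automatic, h being non-degenerate. *)
Definition symplectic_omegahat (S : cdv_structure F) : Prop :=
  forall p, atlas A p -> forall X Y Z : V -> realvec R m,
    rsmoothV (img p) X -> rsmoothV (img p) Y -> rsmoothV (img p) Z ->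
    forall x, img p x -> dform2 (omegahat S p) X Y Z x = 0.

Definition cdv_plus (S : cdv_structure F) : Prop :=
  forall p, atlas A p -> forall x, img p x ->
    forall u, u != 0 -> 0 < cdv_h S p x u u.

Definition kahler (S : cdv_structure F) : Prop :=
  cdv_plus S /\ symplectic_omegahat S.

End Notions.

Section Coincidence.
Context {R : realType} {m : nat} {M : topologicalType}.
Variable A : complex_manifold R m M.
Local Notation V := 'rV[R[i]]_m.

Definition coincide10 (G1 G2 : chart R m M -> V -> V -> V -> V) : Prop :=
  forall p, atlas A p -> forall X s, smoothV (img p) X -> smoothV (img p) s ->
  forall x, img p x -> cov (G1 p) X s x = cov (G2 p) X s x.

Definition coincide_via_Re (G : chart R m M -> V -> V -> V -> V)
    (Gh : chart R m M -> V -> realvec R m -> realvec R m -> realvec R m) : Prop :=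
  forall p, atlas A p -> forall W X, holomorphicV (img p) W -> rsmoothV (img p) X ->
  forall x, img p x ->
  toRe (cov (G p) (fun y => part10 (X y)) W x)
  = rcov (Gh p) X (fun y => toRe (W y)) x.

End Coincidence.

(* Main.v *)
Require Import Defs.
From HB Require Import structures.
From mathcomp Require Import all_boot all_order all_algebra.
From mathcomp Require Import all_classical all_reals all_analysis.
From mathcomp Require Import complex.
From mathcomp Require Import ring lra.
Set Implicit Arguments.
Unset Strict Implicit.
Unset Printing Implicit Defensive.
Import Order.TTheory GRing.Theory Num.Theory.
Import numFieldNormedType.Exports.
Local Open Scope ring_scope.
Local Open Scope complex_scope.
Local Open Scope classical_set_scope.

(** In all the situations that the theorem excludes, the Chern connection [D'] is
    torsion-free, and a semi-simple CDV-structure with torsion-free [D'] has a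
    trivial underlying Frobenius manifold.

    Reduction to a torsion-free [D'].  If [omegahat] is closed, Cartan's formula
    on constant fields says that a cyclic sum of imaginary parts of
    [h (D'_u v - D'_v u, w)] vanishes; the terms are separated by multiplying two
    of the arguments by i, and the torsion vanishes ([closed_torsion_free]).  If
    [D'] coincides with [nabla] or with [nablahat], it inherits their symmetry.  If
    [nabla] coincides with [nablahat], it preserves the real part of [h], and being
    complex linear it preserves [h]; so [nabla] is the Chern connection
    ([metric_10_unique]), and this is the preceding case.

    The torsion-free case.  On constant fields, the curvature equation of a
    CV-structure reads
      dbar_v (D'_u w) = u o K_v w - K_v (u o w),   K_v w = kappa (v o kappa w).
    Without torsion the left-hand side is symmetric in [u] and [w], and setting
    [w = e] shows that [K_v] is multiplication by [K_v e] ([conj_mul_is_mul]).  In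
    canonical coordinates this forces [kappa] to permute the coordinate lines
    ([kappa_delta_line]).  Since [D' kappa = kappa dbar] kills the fields
    [kappa (d/du^a)], the connection [D'] preserves the coordinate lines; torsion
    freeness and [D'_e e = 0] then give [D' (d/du^a) = 0] ([D_eq0]).  So the
    coefficients of [kappa] and of [h], and with them those of [g], are locally
    constant ([metric_locally_cst]).  Consequently the canonical coordinates are
    flat ([nabla_eq0]) and [sum_a eta_a (u^a)^3 / 6] is a potential. *)

(** * Derivatives on polydiscs *)

Section Calculus.
Context {R : realType} {m : nat}.
Local Notation C := R[i].
Local Notation V := 'rV[C]_m.

Definition polydisc (x : V) (r : R) : set V :=
  [set y | forall k, `|x 0 k - y 0 k| < r%:C].

Lemma nbhs_polydisc (x : V) (U : set V) :
  nbhs x U <-> exists2 r : R, 0 < r & polydisc x r `<=` U.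
Proof.
split.
- move=> /nbhs_ballP[e /= e0 xU].
  have [e1 e2] : e = (complex.Re e)%:C /\ 0 < complex.Re e.
    by move: e0; rewrite ltcE => /andP[/eqP /= ie re]; split=> //; case: e ie {xU re} => a b /= ->.
  exists (complex.Re e) => // y xy; apply: xU; split => // i j.
  by rewrite (ord1 i) e1; exact: xy.
- move=> [r r0 xU]; apply/nbhs_ballP; exists r%:C => /=; first by rewrite ltcR.
  move=> y [_ xy]; apply: xU => k; exact: (xy 0 k).
Qed.

Lemma polydisc_center (x : V) (r : R) : 0 < r -> polydisc x r x.
Proof. by move=> r0 k; rewrite subrr normr0 ltcR. Qed.

(** The positive part of the smallest margin [r - |x_k - y_k|] serves as a radius
    around [y]; when [r <= 0] the polydisc is everything or empty according to
    whether the dimension is 0. *)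
Lemma open_polydisc (x : V) (r : R) : open (polydisc x r).
Proof.
have normR (z : C) : `|z| = (complex.Re `|z|)%:C by rewrite normc_def.
rewrite openE => y xy; rewrite /interior; apply/nbhs_polydisc.
have [r0|r0] := ltP 0 r; last first.
  exists 1; first exact: ltr01.
  move=> z _ k; have := xy k.
  have N0 : 0 <= complex.Re `|x 0 k - y 0 k| by rewrite -lecR -normR normr_ge0.
  by rewrite normR ltcR ltNge (le_trans r0 N0).
pose d k := r - complex.Re `|x 0 k - y 0 k|.
have [/= s sr s0] : exists2 s : R, (forall k, `|x 0 k - y 0 k| + s%:C <= r%:C) & 0 < s.
  exists (\big[Order.min/r]_k d k).
    by move=> k; rewrite normR -rmorphD /= lecR -lerBrDl; exact: bigmin_le.
  by apply: lt_bigmin => // k _; have := xy k; rewrite normR ltcR subr_gt0.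
exists s => // z yz k; apply: lt_le_trans (sr k).
rewrite -(subrKA (y 0 k)); apply: le_lt_trans (ler_normD _ _) _.
by rewrite ltrD2l.
Qed.

Lemma line_polydisc (x : V) (r : R) (j : 'I_m) (w : C) (t : R) :
  w = 1 \/ w = 'i%C -> `|t| < r -> polydisc x r (line w j x t).
Proof.
move=> ww tr k; rewrite /line !mxE eqxx /= opprD addrA subrr sub0r normrN !normrM.
have -> : `|w| = 1.
  by case: ww => -> ; rewrite ?normr1 // normc_def /= expr0n /= add0r expr1n sqrtr1.
rewrite mulr1 normc_def /= expr0n /= addr0 sqrtr_sqr.
case: (k == j); rewrite ?normr1 ?normr0 ?mulr1 ?mulr0 ltcR //.
by apply: le_lt_trans tr.
Qed.

Lemma near_line (x : V) (U : set V) (j : 'I_m) (w : C) :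
  w = 1 \/ w = 'i%C -> nbhs x U -> \forall t \near (0 : R), U (line w j x t).
Proof.
move=> ww /nbhs_polydisc[r r0 xU]; apply/nbhs_ballP; exists r => //= t.
rewrite /ball /= sub0r normrN => tr; exact/xU/line_polydisc.
Qed.

Lemma line0 (w : C) j (x : V) : line w j x 0 = x.
Proof. by rewrite /line mul0r scale0r addr0. Qed.

Lemma lineE (w : C) j (x : V) (t : R) k :
  line w j x t 0 k = x 0 k + t%:C * w * (k == j)%:R.
Proof. by rewrite /line !mxE eqxx. Qed.

Lemma lineD (w : C) j (x : V) (s t : R) : line w j x (s + t) = line w j (line w j x s) t.
Proof. by rewrite /line rmorphD /= mulrDl scalerDl addrA. Qed.

(** Derivatives at a point depend on the germ only.  The structures are known on the
    image of a chart, so this is how identities on that image get differentiated. *)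
Lemma near_partial (w : C) j (f g : V -> R) x : w = 1 \/ w = 'i%C ->
  (\forall y \near x, f y = g y) -> partial w j f x = partial w j g x.
Proof.
move=> ww fg; rewrite /partial !derive1E; apply: near_eq_derive.
exact: (near_line _ ww fg).
Qed.

Lemma near_cpartial (w : C) j (f g : V -> C) x : w = 1 \/ w = 'i%C ->
  (\forall y \near x, f y = g y) -> cpartial w j f x = cpartial w j g x.
Proof.
move=> ww fg; rewrite /cpartial; congr (_ +i* _);
  by apply: near_partial => //; apply: filterS fg => y ->.
Qed.

Lemma near_dz j (f g : V -> C) x :
  (\forall y \near x, f y = g y) -> dz j f x = dz j g x.
Proof. by move=> fg; rewrite /dz !(near_cpartial _ _ fg); auto. Qed.

Lemma near_dzbar j (f g : V -> C) x :
  (\forall y \near x, f y = g y) -> dzbar j f x = dzbar j g x.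
Proof. by move=> fg; rewrite /dzbar !(near_cpartial _ _ fg); auto. Qed.

Lemma near_der u (f g : V -> C) x :
  (\forall y \near x, f y = g y) -> der u f x = der u g x.
Proof. by move=> fg; apply: eq_bigr => j _; rewrite (near_dz _ fg). Qed.

Lemma near_derbar u (f g : V -> C) x :
  (\forall y \near x, f y = g y) -> derbar u f x = derbar u g x.
Proof. by move=> fg; apply: eq_bigr => j _; rewrite (near_dzbar _ fg). Qed.

Lemma near_derV u (f g : V -> V) x :
  (\forall y \near x, f y = g y) -> derV u f x = derV u g x.
Proof.
by move=> fg; apply/rowP => k; rewrite !mxE; apply: near_der; apply: filterS fg => y ->.
Qed.

Lemma near_derbarV u (f g : V -> V) x :
  (\forall y \near x, f y = g y) -> derbarV u f x = derbarV u g x.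
Proof.
by move=> fg; apply/rowP => k; rewrite !mxE; apply: near_derbar; apply: filterS fg => y ->.
Qed.

Lemma partial_cst w j (c : R) (x : V) : partial w j (fun=> c) x = 0.
Proof. by rewrite /partial derive1_cst. Qed.

Lemma cpartial_cst w j (c : C) (x : V) : cpartial w j (fun=> c) x = 0.
Proof. by rewrite /cpartial !partial_cst. Qed.

Lemma dz_cst j (c : C) (x : V) : dz j (fun=> c) x = 0.
Proof. by rewrite /dz !cpartial_cst mulr0 subr0 mul0r. Qed.

Lemma dzbar_cst j (c : C) (x : V) : dzbar j (fun=> c) x = 0.
Proof. by rewrite /dzbar !cpartial_cst mulr0 addr0 mul0r. Qed.

Lemma der_cst u (c : C) (x : V) : der u (fun=> c) x = 0.
Proof. by rewrite /der big1 // => j _; rewrite dz_cst mulr0. Qed.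

Lemma derbar_cst u (c : C) (x : V) : derbar u (fun=> c) x = 0.
Proof. by rewrite /derbar big1 // => j _; rewrite dzbar_cst mulr0. Qed.

Lemma derV_cst u (c x : V) : derV u (fun=> c) x = 0.
Proof. by apply/rowP => k; rewrite !mxE der_cst. Qed.

Lemma derbarV_cst u (c x : V) : derbarV u (fun=> c) x = 0.
Proof. by apply/rowP => k; rewrite !mxE derbar_cst. Qed.

Lemma der_delta a (f : V -> C) (x : V) : der (delta_mx 0 a) f x = dz a f x.
Proof.
rewrite /der (bigD1 a) //= big1 ?addr0 => [|j ja]; first by rewrite mxE !eqxx mul1r.
by rewrite mxE (negbTE ja) andbF mul0r.
Qed.

Lemma derbar_delta a (f : V -> C) (x : V) : derbar (delta_mx 0 a) f x = dzbar a f x.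
Proof.
rewrite /derbar (bigD1 a) //= big1 ?addr0 => [|j ja].
  by rewrite mxE !eqxx conjc1 mul1r.
by rewrite mxE (negbTE ja) andbF conjc0 mul0r.
Qed.

Lemma Ck_sub k (U U' : set V) (f : V -> R) : U' `<=` U -> Ck k U f -> Ck k U' f.
Proof.
move=> UU; elim: k f => [|k IH] f /= [fc fd]; split=> //; try by move=> x /UU/fc.
move=> j w ww; have [h1 h2] := fd j w ww; split; first by move=> x /UU/h1.
exact: IH.
Qed.

Lemma holomorphicV_sub (U U' : set V) (s : V -> V) :
  U' `<=` U -> holomorphicV U s -> holomorphicV U' s.
Proof.
move=> UU hs k; have [[h1 h2] h3] := hs k; split; first split.
- by move=> n; apply: Ck_sub UU (h1 n).
- by move=> n; apply: Ck_sub UU (h2 n).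
- by move=> j x /UU; exact: h3.
Qed.

Lemma rsmooth_cst (U : set V) (c : R) : rsmooth U (fun=> c).
Proof.
move=> k; elim: k c => [|k IH] c; split=> //; try by move=> x _; exact: cst_continuous.
move=> j w _; split; first by move=> x _; exact: derivable_cst.
by rewrite (_ : partial w j _ = (fun=> 0)) //; apply/funext => x; rewrite partial_cst.
Qed.

Lemma smoothV_cst (U : set V) (c : V) : smoothV U (fun=> c).
Proof. by move=> k; split; exact: rsmooth_cst. Qed.

Lemma holomorphicV_cst (U : set V) (c : V) : holomorphicV U (fun=> c).
Proof. by move=> k; split; [exact: smoothV_cst | move=> j x _; exact: dzbar_cst]. Qed.

(** The mean value theorem along a coordinate line. *)
Lemma cst_line (U : set V) (f : V -> R) (w : C) j (x : V) (s : R) :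
  (forall y, U y -> has_partial w j f y /\ partial w j f y = 0) ->
  (forall t, `|t| <= `|s| -> U (line w j x t)) ->
  f (line w j x s) = f x.
Proof.
move=> fU xU.
pose g t := f (line w j x t).
have dg t : `|t| <= `|s| -> is_derive t (1 : R) g 0.
  move=> /xU/fU[h1 h2].
  have -> : g = (fun u => f (line w j (line w j x t) u)) \o (fun u => u - t).
    by apply/funext => u /=; rewrite /g -lineD subrKC.
  have hd : is_derive (t - t) (1 : R) (fun u => f (line w j (line w j x t) u)) 0.
    rewrite subrr; apply: DeriveDef => //.
    by move: h2; rewrite /partial derive1E.
  have := @is_derive1_comp R _ (fun u => u - t) t 0 1 hd.
  by rewrite mul0r; apply; apply: is_derive_eq (subr0 _).
rewrite -[in RHS](line0 w j x) -/(g s) -/(g 0).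
have cg (a b : R) : `|a| <= `|s| -> `|b| <= `|s| -> a <= b -> g b = g a.
  move=> as_ bs ab.
  have inab t : t \in `[a, b]%R -> `|t| <= `|s|.
    rewrite in_itv /= => /andP[at_ tb]; rewrite ler_norml.
    move: as_ bs; rewrite !ler_norml => /andP[h1 h2] /andP[h3 h4].
    by rewrite (le_trans h1 at_) (le_trans tb h4).
  have gab t : t \in `]a, b[%R -> is_derive t (1 : R) g 0.
    by move=> tab; apply/dg/inab/subset_itv_oo_cc.
  have [|c _] := MVT_segment ab gab.
    apply: derivable_within_continuous => t tab; have := dg _ (inab _ tab).
    by case.
  by rewrite mul0r => /eqP; rewrite subr_eq0 => /eqP.
have s0 : `|(0:R)| <= `|s| by rewrite normr0.
by have [ss|ss] := leP 0 s; [apply: cg | symmetry; apply: cg => //; exact: ltW].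
Qed.


Lemma normc_le (c d : C) : `|complex.Re c| <= `|complex.Re d| ->
  `|complex.Im c| <= `|complex.Im d| -> `|c| <= `|d|.
Proof.
move=> h1 h2; rewrite !normc_def lecR; apply: ler_wsqrtr.
by rewrite lerD // -[leLHS]real_normK ?num_real // -[leRHS]real_normK ?num_real //
  ler_sqr ?nnegrE.
Qed.

(** From the centre [x] to [y], change the real and imaginary parts of the
    coordinates one at a time: as [x] is the centre, the path stays in the
    polydisc. *)
Lemma cst_polydisc (f : V -> R) (x : V) (r : R) :
  (forall j w, w = 1 \/ w = 'i%C -> forall y, polydisc x r y ->
    has_partial w j f y /\ partial w j f y = 0) ->
  forall y, polydisc x r y -> f y = f x.
Proof.
move=> df y xy.
(* The path reaches [z n] when the first [n] coordinates have been changed. *)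
pose z n : V := \row_k (if (k < n)%N then y 0 k else x 0 k).
have -> : y = z m by apply/rowP => k; rewrite mxE ltn_ord.
suff H n : (n <= m)%N -> f (z n) = f x by exact: H.
elim: n => [_|n IH nm]; first by congr f; apply/rowP => k; rewrite mxE ltn0.
rewrite -{}IH 1?ltnW //; pose j : 'I_m := Ordinal nm; pose d := y 0 j - x 0 j.
pose z' := line 1 j (z n) (complex.Re d).
have zS : z n.+1 = line 'i%C j z' (complex.Im d).
  apply/rowP => k; rewrite /z' /line !mxE eqxx /= ltnS; have [->|kj] := eqVneq k j.
    rewrite /= leqnn ltnn !mulr1 -addrA [_%:C * _]mulrC -complexE /d.
    by rewrite addrC subrK.
  by rewrite !mulr0 !addr0 ltn_neqAle -[n]/(val j) val_eqE kj.
have inU (v : V) : (forall k, k != j -> v 0 k = z n 0 k) ->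
    `|complex.Re (v 0 j - x 0 j)| <= `|complex.Re d| ->
    `|complex.Im (v 0 j - x 0 j)| <= `|complex.Im d| -> polydisc x r v.
  move=> vz vr vi k; have [->|kj] := eqVneq k j.
    apply: le_lt_trans (xy j); rewrite -normrN opprB -[leRHS]normrN opprB.
    exact: normc_le.
  rewrite vz // mxE; case: ifP => _; first exact: xy.
  by rewrite subrr normr0; apply: le_lt_trans (xy k).
have znj : z n 0 j = x 0 j by rewrite mxE ltnn.
rewrite zS (cst_line (df j 'i%C (or_intror erefl))); last first.
  have e (t : R) : line 'i%C j z' t 0 j - x 0 j = (complex.Re d)%:C + t%:C * 'i%C.
    by rewrite /z' !lineE znj eqxx !mulr1; ring.
  move=> t td; apply: inU => [k kj||].
  - by rewrite /z' !lineE (negbTE kj) !mulr0 !addr0.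
  - by rewrite e /= mul0r mulr0 subrr addr0.
  - by rewrite e /= mul0r mulr1 addr0 add0r.
rewrite (cst_line (df j 1 (or_introl erefl))) // => t td.
have e : line 1 j (z n) t 0 j - x 0 j = t%:C.
  by rewrite !lineE znj eqxx !mulr1 addrC addKr.
apply: inU => [k kj||].
- by rewrite !lineE (negbTE kj) !mulr0 !addr0.
- by rewrite e.
- by rewrite e /= normr0.
Qed.

Lemma cst_polydiscC (U : set V) (f : V -> C) (x : V) (r : R) :
  smooth U f -> polydisc x r `<=` U ->
  (forall j y, U y -> dz j f y = 0 /\ dzbar j f y = 0) ->
  forall y, polydisc x r y -> f y = f x.
Proof.
move=> [fr fi] xU fd y xy.
have cp0 j w z : w = 1 \/ w = 'i%C -> U z -> cpartial w j f z = 0.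
  move=> ww /(fd j)[]; rewrite /dz /dzbar => /eqP; rewrite mulf_eq0 invr_eq0 pnatr_eq0 orbF.
  rewrite subr_eq0 => /eqP e1 /eqP; rewrite mulf_eq0 invr_eq0 pnatr_eq0 orbF e1.
  rewrite -mulr2n mulrn_eq0 /= mulf_eq0 => /orP[/eqP/(congr1 (@complex.Im _))/= /eqP|/eqP e2].
    by rewrite oner_eq0.
  by case: ww => ->; [rewrite e1 e2 mulr0 | exact: e2].
have rec (p : C -> R) : rsmooth U (fun z => p (f z)) ->
   (forall j w z, w = 1 \/ w = 'i%C -> U z -> partial w j (fun z => p (f z)) z = 0) ->
   p (f y) = p (f x).
  move=> ps p0; apply: (@cst_polydisc (fun z => p (f z)) x r) => // j w ww z /xU Uz.
  by split; [have [_ /(_ j w ww)[+ _]] := ps 1; apply | apply: p0].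
rewrite [f y]complexE [f x]complexE; congr (_%:C + _ * _%:C).
- by apply: rec fr _ => j w z ww Uz; have /(congr1 (@complex.Re _)) := cp0 j w z ww Uz.
- by apply: rec fi _ => j w z ww Uz; have /(congr1 (@complex.Im _)) := cp0 j w z ww Uz.
Qed.

(** * Polynomials in the holomorphic coordinates *)

(** Phrased with derivatives along real lines, as [partial] is.  The two
    directions [1] and ['i] share the same [f'], which is the Cauchy-Riemann
    equation: hence [has_dzE] and [has_dzbarE]. *)
Definition has_dz j (f f' : V -> C) := forall x w, w = 1 \/ w = 'i%C ->
  is_derive (0 : R) (1 : R) (fun t : R => complex.Re (f (line w j x t))) (complex.Re (w * f' x)) /\
  is_derive (0 : R) (1 : R) (fun t : R => complex.Im (f (line w j x t))) (complex.Im (w * f' x)).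

Lemma has_dz_cpartial j f f' w x : w = 1 \/ w = 'i%C ->
  has_dz j f f' -> cpartial w j f x = w * f' x.
Proof.
move=> ww /(_ x w ww)[[h1 h1'] [h2 h2']].
by rewrite /cpartial /partial !derive1E h1' h2'; case: (w * f' x).
Qed.

Lemma has_dzE j f f' : has_dz j f f' -> dz j f = f'.
Proof.
move=> h; apply/funext => x; rewrite /dz !(has_dz_cpartial _ _ h); auto.
by rewrite mul1r mulrA -expr2 sqr_i mulN1r opprK -mulr2n -[f' x *+ 2]mulr_natr mulfK ?pnatr_eq0.
Qed.

Lemma has_dzbarE j f f' : has_dz j f f' -> dzbar j f = (fun=> 0).
Proof.
move=> h; apply/funext => x; rewrite /dzbar !(has_dz_cpartial _ _ h); auto.
by rewrite mul1r mulrA -expr2 sqr_i mulN1r subrr mul0r.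
Qed.

Lemma has_dz_cst j (c : C) : has_dz j (fun=> c) (fun=> 0).
Proof. by move=> x w _; rewrite mulr0 /=; split; exact: is_derive_cst. Qed.

Lemma has_dz_coord j k : has_dz j (fun x => x 0 k) (fun=> (k == j)%:R).
Proof.
move=> x w _.
have lin (a b : R) : is_derive (0 : R) (1 : R) (fun t : R => a + b * t) b.
  have : is_derive (0 : R) (1 : R) (cst a + b *: (id : R -> R)) (0 + b *: 1).
    by apply: is_deriveD.
  by rewrite add0r [b *: 1]mulr1.
split; rewrite /line.
- rewrite (_ : (fun t => _) = (fun t => complex.Re (x 0 k) + complex.Re (w * (k == j)%:R) * t)) //.
  apply/funext => t; rewrite !mxE eqxx /= raddfD /=; congr (_ + _).
  rewrite -mulrA; case: (w * (k == j)%:R) => a b /=; ring.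
- rewrite (_ : (fun t => _) = (fun t => complex.Im (x 0 k) + complex.Im (w * (k == j)%:R) * t)) //.
  apply/funext => t; rewrite !mxE eqxx /= raddfD /=; congr (_ + _).
  rewrite -mulrA; case: (w * (k == j)%:R) => a b /=; ring.
Qed.

Lemma has_dzD j f f' g g' : has_dz j f f' -> has_dz j g g' ->
  has_dz j (fun x => f x + g x) (fun x => f' x + g' x).
Proof.
move=> hf hg x w ww; have [f1 f2] := hf x w ww; have [g1 g2] := hg x w ww.
rewrite mulrDr !raddfD /=; split.
- rewrite (_ : (fun t => _) = (fun t => complex.Re (f (line w j x t)))
                            + (fun t => complex.Re (g (line w j x t)))).
    exact: is_deriveD.
  by apply/funext => t; rewrite raddfD.
- rewrite (_ : (fun t => _) = (fun t => complex.Im (f (line w j x t)))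
                            + (fun t => complex.Im (g (line w j x t)))).
    exact: is_deriveD.
  by apply/funext => t; rewrite raddfD.
Qed.

Lemma has_dzM j f f' g g' : has_dz j f f' -> has_dz j g g' ->
  has_dz j (fun x => f x * g x) (fun x => f' x * g x + f x * g' x).
Proof.
move=> hf hg x w ww; have [f1 f2] := hf x w ww; have [g1 g2] := hg x w ww.
rewrite mulrDr mulrA [w * (_ * _)]mulrCA.
set fr := (fun t => complex.Re (f _)) in f1; set fi := (fun t => complex.Im (f _)) in f2.
set gr := (fun t => complex.Re (g _)) in g1; set gi := (fun t => complex.Im (g _)) in g2.
have e : fr 0 = complex.Re (f x) /\ fi 0 = complex.Im (f x) /\
  gr 0 = complex.Re (g x) /\ gi 0 = complex.Im (g x) by rewrite /fr /fi /gr /gi line0.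
case: e => e1 [e2 [e3 e4]]; split.
- rewrite (_ : (fun t => _) = fr * gr - fi * gi); last first.
    by apply/funext => t; rewrite /fr /fi /gr /gi !fctE; case: (f _) => ? ?; case: (g _).
  apply: is_derive_eq; rewrite e1 e2 e3 e4 /GRing.scale /=.
  case: (w * f' x) => ? ?; case: (w * g' x) => ? ?; case: (f x) => ? ?; case: (g x) => ? ? /=.
  ring.
- rewrite (_ : (fun t => _) = fr * gi + fi * gr); last first.
    by apply/funext => t; rewrite /fr /fi /gr /gi !fctE; case: (f _) => ? ?; case: (g _).
  apply: is_derive_eq; rewrite e1 e2 e3 e4 /GRing.scale /=.
  case: (w * f' x) => ? ?; case: (w * g' x) => ? ?; case: (f x) => ? ?; case: (g x) => ? ? /=.
  ring.
Qed.

(** Closed under complex partial derivatives, so that smoothness of all orders is an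
    induction on the order, for all these functions at once. *)
Inductive polyfun : (V -> C) -> Prop :=
| polyfun_cst c : polyfun (fun=> c)
| polyfun_coord k : polyfun (fun x => x 0 k)
| polyfunD f g : polyfun f -> polyfun g -> polyfun (fun x => f x + g x)
| polyfunM f g : polyfun f -> polyfun g -> polyfun (fun x => f x * g x).

Lemma polyfun_dz f : polyfun f -> forall j, exists2 f', has_dz j f f' & polyfun f'.
Proof.
move=> + j; elim=> {f} [c|k|f g pf [f' hf pf'] pg [g' hg pg']|f g pf [f' hf pf'] pg [g' hg pg']].
- by exists (fun=> 0); [exact: has_dz_cst | constructor].
- by exists (fun=> (k == j)%:R); [exact: has_dz_coord | constructor].
- by exists (fun x => f' x + g' x); [exact: has_dzD | constructor].
- by exists (fun x => f' x * g x + f x * g' x); [exact: has_dzM | do ?constructor].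
Qed.

Lemma Re_continuous : continuous (@complex.Re R : C -> R).
Proof.
move=> z; apply/(@cvgrPdist_lt _ _ _ _ (@nbhs_filter C z)) => e e0.
apply/(@nbhs_ballP _ C); exists e%:C => /=; first by rewrite ltcR.
move=> y; rewrite /ball /= => h; rewrite -raddfB /= -ltcR; apply: le_lt_trans h.
exact: normc_ge_Re.
Qed.

Lemma Im_continuous : continuous (@complex.Im R : C -> R).
Proof.
move=> z; apply/(@cvgrPdist_lt _ _ _ _ (@nbhs_filter C z)) => e e0.
apply/(@nbhs_ballP _ C); exists e%:C => /=; first by rewrite ltcR.
move=> y; rewrite /ball /= => h; rewrite -raddfB /= -ltcR; apply: le_lt_trans h.
by have := normc_ge_Re ((z - y) * 'i%C); rewrite ReiNIm normrN normrM
  [`|'i%C|]normc_def /= expr0n expr1n add0r sqrtr1 mulr1.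
Qed.

Lemma polyfun_continuous f : polyfun f -> continuous f.
Proof.
elim=> {f} [c|k|f g _ cf _ cg|f g _ cf _ cg] x.
- exact: cst_continuous.
- exact: coord_continuous.
- exact: cvgD (cf x) (cg x).
- exact: cvgM (cf x) (cg x).
Qed.

Lemma polyfun_holomorphic U f : polyfun f -> holomorphic U f.
Proof.
move=> pf; split; last first.
  by move=> j x _; have [f' /has_dzbarE ->] := polyfun_dz pf j.
suff H k g : polyfun g -> Ck k U (fun x => complex.Re (g x)) /\ Ck k U (fun x => complex.Im (g x)).
  by split=> k; have [] := H k f pf.
elim: k g => [|k IH] g pg /=.
  have cg := polyfun_continuous pg; do 2?split=> //.
    by move=> x _; apply: continuous_comp (cg x) _; exact: Re_continuous.
  by move=> x _; apply: continuous_comp (cg x) _; exact: Im_continuous.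
have cg := polyfun_continuous pg; split; split.
- by move=> x _; apply: continuous_comp (cg x) _; exact: Re_continuous.
- move=> j w ww; have [g' hg pg'] := polyfun_dz pg j; split.
    by move=> x _; have [[]] := hg x w ww.
  rewrite (_ : partial w j _ = (fun x => complex.Re (w * g' x))).
    by apply: (IH (fun x => w * g' x) _).1; do ?constructor.
  by apply/funext => x; have [[_ h] _] := hg x w ww; rewrite /partial derive1E.
- by move=> x _; apply: continuous_comp (cg x) _; exact: Im_continuous.
- move=> j w ww; have [g' hg pg'] := polyfun_dz pg j; split.
    by move=> x _; have [_ []] := hg x w ww.
  rewrite (_ : partial w j _ = (fun x => complex.Im (w * g' x))).
    by apply: (IH (fun x => w * g' x) _).2; do ?constructor.
  by apply/funext => x; have [_ [_ h]] := hg x w ww; rewrite /partial derive1E.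
Qed.

Lemma derV_id (u x : V) : derV u id x = u.
Proof.
apply/rowP => k; rewrite mxE /der (bigD1 k) //= big1 ?addr0.
  by rewrite (has_dzE (has_dz_coord k k)) eqxx mulr1.
by move=> j jk; rewrite (has_dzE (has_dz_coord j k)) eq_sym (negbTE jk) mulr0.
Qed.

End Calculus.

(** * Reduction to a torsion-free Chern connection *)

Section Reductions.
Context {R : realType} {m : nat}.
Local Notation C := R[i].
Local Notation V := 'rV[C]_m.

(** [u + conj u] is the real vector field [toRe u]. *)
Lemma der_derbar_split (u : V) (f : V -> C) x :
  der u f x + derbar u f x =
  \sum_j ((complex.Re (u 0 j))%:C * cpartial 1 j f x
          + (complex.Im (u 0 j))%:C * cpartial 'i%C j f x).
Proof.
rewrite /der /derbar -big_split /=; apply: eq_bigr => j _; rewrite /dz /dzbar.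
have -> : (u 0 j)^*%C = (complex.Re (u 0 j))%:C - 'i%C * (complex.Im (u 0 j))%:C.
  by case: (u 0 j) => a b; simpc.
rewrite [in u 0 j * _](complexE (u 0 j)).
have h2 : (2 : C) * 2^-1 = 1 by rewrite mulfV ?pnatr_eq0.
have := sqr_i R; move: ('i%C : C) (cpartial _ _ _ _) (cpartial _ _ _ _) => i c d i2.
move: ((complex.Re _)%:C) ((complex.Im _)%:C) (2^-1) h2 => a b t h2.
ring: h2 i2.
Qed.

Lemma rder_Re (u : V) (f : V -> C) x :
  rder (toRe u) (fun y => complex.Re (f y)) x = complex.Re (der u f x + derbar u f x).
Proof.
rewrite der_derbar_split raddf_sum; apply: eq_bigr => j _.
have E (a b : R) (z w : C) :
    complex.Re (a%:C * z + b%:C * w) = a * complex.Re z + b * complex.Re w.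
  by case: z w => p q [r s]; rewrite /= !mul0r !subr0.
by rewrite [RHS]E !mxE.
Qed.

Lemma rder_Im (u : V) (f : V -> C) x :
  rder (toRe u) (fun y => complex.Im (f y)) x = complex.Im (der u f x + derbar u f x).
Proof.
rewrite der_derbar_split raddf_sum; apply: eq_bigr => j _.
have E (a b : R) (z w : C) :
    complex.Im (a%:C * z + b%:C * w) = a * complex.Im z + b * complex.Im w.
  by case: z w => p q [r s]; rewrite /= !mul0r !addr0.
by rewrite [RHS]E !mxE.
Qed.

Lemma toReK : cancel (@toRe R m) (@part10 R m).
Proof. by move=> u; apply/rowP => j; rewrite !mxE /=; case: (u 0 j). Qed.

Lemma rderV_cst (X Y : realvec R m) (x : V) : rderV X (fun=> Y) x = 0.
Proof.
congr pair; apply/rowP => k; rewrite !mxE /rder big1 // => j _.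
  by rewrite !partial_cst !mulr0 addr0.
by rewrite !partial_cst !mulr0 addr0.
Qed.

Lemma rsmoothV_cst (U : set V) (X : realvec R m) : rsmoothV U (fun=> X).
Proof. by move=> k; split; exact: rsmooth_cst. Qed.

Lemma cov_cst (G : V -> V -> V -> V) (X : V -> V) (v x : V) :
  cov G X (fun=> v) x = G x (X x) v.
Proof. by rewrite /cov derV_cst add0r. Qed.

Lemma rcov_cst (G : V -> realvec R m -> realvec R m -> realvec R m) (X Y : realvec R m) (x : V) :
  rcov G (fun=> X) (fun=> Y) x = G x X Y.
Proof. by rewrite /rcov rderV_cst add0r. Qed.

Lemma bracket_cst (u v x : V) : bracket (fun=> u) (fun=> v) x = 0.
Proof. by rewrite /bracket !derV_cst subr0. Qed.

Lemma rbracket_cst (X Y : realvec R m) (x : V) : rbracket (fun=> X) (fun=> Y) x = 0.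
Proof. by rewrite /rbracket !rderV_cst subr0. Qed.

Lemma levi_civita_sym U (g : V -> V -> V -> C) G : levi_civita U g G ->
  forall x u v, U x -> G x u v = G x v u.
Proof.
move=> lc x u v Ux; have := lc_torsion lc (holomorphicV_cst U u) (holomorphicV_cst U v) Ux.
by rewrite !cov_cst bracket_cst => /eqP; rewrite subr_eq0 => /eqP.
Qed.

Lemma real_levi_civita_sym U (g : V -> realvec R m -> realvec R m -> R) G :
  real_levi_civita U g G -> forall x u v, U x -> G x u v = G x v u.
Proof.
move=> lc x u v Ux; have := rlc_torsion lc (rsmoothV_cst U u) (rsmoothV_cst U v) Ux.
by rewrite !rcov_cst rbracket_cst => /eqP; rewrite subr_eq0 => /eqP.
Qed.

Lemma bilin_fieldZl U (G : V -> V -> V -> V) x a u v : bilin_field U G -> U x ->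
  G x (a *: u) v = a *: G x u v.
Proof.
move=> bG Ux; have [_ /(_ v) l] := bG x Ux.
have l0 : G x 0 v = 0.
  by apply: (addrI (G x 0 v)); have := l 1 0 0; rewrite !scale1r !addr0 => <-.
by have := l a u 0; rewrite !addr0 l0 addr0.
Qed.

Lemma bilin_fieldZr U (G : V -> V -> V -> V) x a u v : bilin_field U G -> U x ->
  G x u (a *: v) = a *: G x u v.
Proof.
move=> bG Ux; have [/(_ u) l _] := bG x Ux.
have l0 : G x u 0 = 0.
  by apply: (addrI (G x u 0)); have := l 1 0 0; rewrite !scale1r !addr0 => <-.
by have := l a v 0; rewrite !addr0 l0 addr0.
Qed.

Lemma ImiN (z : C) : complex.Im ('i%C * z) = complex.Re z.
Proof. by rewrite mulrC ImiRe. Qed.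
Lemma ReiN (z : C) : complex.Re ('i%C * z) = - complex.Im z.
Proof. by rewrite mulrC ReiNIm. Qed.
Lemma conji : ('i%C : C)^*%C = - 'i%C.
Proof. by apply/eqP; rewrite eq_complex /= oppr0 !eqxx. Qed.

Section Hermitian.
Variables (U : set V) (h : V -> V -> V -> C) (D : V -> V -> V -> V).
Hypothesis Uo : open U.
Hypotheses (hh : hermitian_pseudo_metric U h) (hD : chern U h D).

Lemma hermD x u v w : U x -> h x (u + v) w = h x u w + h x v w.
Proof. by move=> Ux; have := h_linear hh w Ux 1 u v; rewrite !scale1r. Qed.

Lemma herm0 x w : U x -> h x 0 w = 0.
Proof. by move=> Ux; apply: (addrI (h x 0 w)); rewrite -hermD // !addr0. Qed.

Lemma hermZ x a u w : U x -> h x (a *: u) w = a * h x u w.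
Proof. by move=> Ux; have := h_linear hh w Ux a u 0; rewrite !addr0 herm0 ?addr0. Qed.

Lemma hermB x u v w : U x -> h x (u - v) w = h x u w - h x v w.
Proof. by move=> Ux; rewrite hermD // -scaleN1r hermZ // mulN1r. Qed.

Lemma herm0r x u : U x -> h x u 0 = 0.
Proof. by move=> Ux; rewrite (h_herm hh) // herm0 // conjc0. Qed.

Lemma hermZr x a u v : U x -> h x u (a *: v) = a^*%C * h x u v.
Proof. by move=> Ux; have := h_semilinear hh u a v 0 Ux; rewrite !addr0 herm0r ?addr0. Qed.

Lemma herm_eq x u v : U x -> (forall w, h x u w = h x v w) -> u = v.
Proof.
move=> Ux e; apply/eqP; rewrite -subr_eq0; apply/eqP/(h_nondeg hh Ux) => w.
by rewrite hermB // e subrr.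
Qed.

Lemma chern_der x u v w : U x -> der u (fun y => h y v w) x = h x (D x u v) w.
Proof.
move=> Ux; have := chern_h hD u (smoothV_cst U v) (smoothV_cst U w) Ux.
by rewrite /opD' cov_cst /opD'' derbarV_cst herm0r // addr0.
Qed.

Lemma chern_derbar x u v w : U x -> derbar u (fun y => h y v w) x = h x v (D x u w).
Proof.
move=> Ux; have := chern_hbar hD u (smoothV_cst U v) (smoothV_cst U w) Ux.
by rewrite /opD' cov_cst /opD'' derbarV_cst herm0 // add0r.
Qed.

(** With [S a b c = h (D_a b - D_b a) c], closedness on constant fields says that the
    cyclic sum of [Im (S a b c)] is zero.  As [S] is linear in its first two
    arguments and antilinear in the third, replacing [a], [b] by [i a], [i b]
    changes the sign of the first term of the cyclic sum only. *)
Lemma closed_torsion_free :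
  (forall x X Y Z, U x -> dform2 (fun y X Y => - complex.Im (h y (part10 X) (part10 Y)))
      (fun=> X) (fun=> Y) (fun=> Z) x = 0) ->
  forall x u v, U x -> D x u v = D x v u.
Proof.
move=> closed x u v Ux; apply: (herm_eq Ux) => w.
pose S a b c := h x (D x a b) c - h x (D x b a) c.
have cyc a b c : complex.Im (S a b c) + complex.Im (S b c a) + complex.Im (S c a b) = 0.
  have := closed x (toRe a) (toRe b) (toRe c) Ux.
  rewrite /dform2 !rbracket_cst !toReK.
  have part0 : part10 (0 : realvec R m) = 0 by apply/rowP => k; rewrite !mxE.
  rewrite part0 !herm0 //= oppr0 !subr0.
  have rN a' b' c' : rder (toRe a') (fun y => - complex.Im (h y b' c')) x =
    complex.Im (h x (D x a' c') b' + h x c' (D x a' b')).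
    (* The sign is absorbed into a conjugation, hence a swap of the arguments. *)
    rewrite (_ : (fun y => _) = (fun y => complex.Im (h y b' c')^*%C)); last first.
      by apply/funext => y; case: (h y b' c').
    have e : \forall y \near x, (h y b' c')^*%C = h y c' b'.
      by apply: filterS (open_nbhs_nbhs (conj Uo Ux)) => y Uy; rewrite (h_herm hh b').
    by rewrite rder_Im (near_der _ e) (near_derbar _ e) chern_der ?chern_derbar.
  rewrite !rN (h_herm hh (D x a b)) // (h_herm hh (D x b c)) // (h_herm hh (D x c a)) //.
  rewrite /S; move: (h x _ _) (h x _ _) (h x _ _) (h x _ _) (h x _ _) (h x _ _).
  move=> [? ?] [? ?] [? ?] [? ?] [? ?] [? ?] /= => {}e.
  lra.
have bD := chern_bilin hD.
have SZ1 k a b c : S (k *: a) b c = k * S a b c.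
  by rewrite /S (bilin_fieldZl _ _ _ bD) ?(bilin_fieldZr _ _ _ bD) // !hermZ // mulrBr.
have SZ2 k a b c : S a (k *: b) c = k * S a b c.
  by rewrite /S (bilin_fieldZl _ _ _ bD) ?(bilin_fieldZr _ _ _ bD) // !hermZ // mulrBr.
have SZ3 k a b c : S a b (k *: c) = k^*%C * S a b c by rewrite /S !hermZr // mulrBr.
have ImS a b c : complex.Im (S a b c) = 0.
  have := cyc a b c; have := cyc ('i%C *: a) ('i%C *: b) c.
  rewrite !(SZ1, SZ2, SZ3) conji !(mulNr, mulrN) !mulrA -!expr2 sqr_i !mulN1r !opprK.
  rewrite raddfN /= ?mul1r; lra.
apply/eqP; rewrite -subr_eq0 -/(S u v w) eq_complex /= ImS eqxx andbT -ImiN -SZ1 ImS.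
exact: eqxx.
Qed.

(** The Chern connection is determined by the derivatives of the real part of [h].
    The difference [delta] of two such connections satisfies
    [Re (h (delta_a b) c + h b (delta_a c)) = 0], and replacing [a], [b] by [i a],
    [i b] changes the sign of the first term only. *)
Lemma metric_10_unique (G : V -> V -> V -> V) : bilin_field U G ->
  (forall x u v w, U x -> rder (toRe u) (fun y => complex.Re (h y v w)) x =
     complex.Re (h x (G x u v) w + h x v (G x u w))) ->
  forall x u v, U x -> G x u v = D x u v.
Proof.
move=> bG compat x u v Ux; apply/eqP; rewrite -subr_eq0; apply/eqP/(h_nondeg hh Ux) => w.
have bD := chern_bilin hD.
pose d a b := G x a b - D x a b.
have eq1 a b c : complex.Re (h x (d a b) c) + complex.Re (h x b (d a c)) = 0.
  have := compat x a b c Ux; rewrite rder_Re chern_der // chern_derbar // !raddfD /=.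
  rewrite /d [h x b (_ - _)](h_herm hh) // !hermB //.
  rewrite (h_herm hh (G x a c)) // (h_herm hh (D x a c)) //.
  move: (h x _ _) (h x _ _) (h x _ _) (h x _ _) => [? ?] [? ?] [? ?] [? ?] /=; lra.
have dZ1 k a b : d (k *: a) b = k *: d a b.
  by rewrite /d (bilin_fieldZl _ _ _ bD) ?(bilin_fieldZl _ _ _ bG) // scalerBr.
have dZ2 k a b : d a (k *: b) = k *: d a b.
  by rewrite /d (bilin_fieldZr _ _ _ bD) ?(bilin_fieldZr _ _ _ bG) // scalerBr.
have Re0 a b c : complex.Re (h x (d a b) c) = 0.
  have := eq1 a b c; have := eq1 ('i%C *: a) ('i%C *: b) c.
  rewrite !(dZ1, dZ2) !hermZ // hermZr // conji !(mulNr, mulrN) !mulrA -!expr2.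
  rewrite sqr_i !mulN1r !opprK ?mul1r.
  rewrite raddfN /= ?mul1r; lra.
rewrite -/(d u v); apply/eqP; rewrite eq_complex Re0 eqxx /=.
by apply/eqP/oppr_inj; rewrite oppr0 -ReiN -hermZ // -dZ1 Re0.
Qed.

End Hermitian.
End Reductions.

(** * Torsion-free CV-structures in canonical coordinates *)

Section CanonicalChart.
Context {R : realType} {m : nat}.
Local Notation C := R[i].
Local Notation V := 'rV[C]_m.
Local Notation eps a := (delta_mx 0 a : V).

Lemma linear_delta (W : lmodType C) (f : V -> W) u : linear f ->
  f u = \sum_a u 0 a *: f (eps a).
Proof.
move=> lf; have fD v w : f (v + w) = f v + f w by have := lf 1 v w; rewrite !scale1r.
have f0 : f 0 = 0 by apply: (addrI (f 0)); rewrite -fD !addr0.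
have fZ k v : f (k *: v) = k *: f v by have := lf k v 0; rewrite f0 !addr0.
by rewrite {1}[u]row_sum_delta (big_morph f fD f0); apply: eq_bigr => a _; rewrite fZ.
Qed.

Lemma sum_delta (c : 'I_m -> C) k : (\sum_a c a *: eps a) 0 k = c k.
Proof.
rewrite summxE (bigD1 k) //= big1 ?addr0 => [|j jk].
  by rewrite !mxE !eqxx mulr1.
by rewrite !mxE eq_sym (negbTE jk) andbF mulr0.
Qed.

Lemma deltaE a k : eps a 0 k = (k == a)%:R.
Proof. by rewrite mxE eqxx. Qed.

Lemma bilin_field0l (G : V -> V -> V -> V) U x v : bilin_field U G -> U x -> G x 0 v = 0.
Proof. by move=> bG Ux; rewrite -[0 in LHS](scale0r 0) (bilin_fieldZl _ _ _ bG) // scale0r. Qed.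

Lemma bilin_field0r (G : V -> V -> V -> V) U x v : bilin_field U G -> U x -> G x v 0 = 0.
Proof. by move=> bG Ux; rewrite -[0 in LHS](scale0r 0) (bilin_fieldZr _ _ _ bG) // scale0r. Qed.

Lemma bilin_fieldNr (G : V -> V -> V -> V) U x u v : bilin_field U G -> U x ->
  G x u (- v) = - G x u v.
Proof. by move=> bG Ux; rewrite -scaleN1r (bilin_fieldZr _ _ _ bG) // scaleN1r. Qed.

Lemma der0 (f : V -> C) x : der 0 f x = 0.
Proof. by rewrite /der big1 // => j _; rewrite mxE mul0r. Qed.
Lemma derbar0 (f : V -> C) x : derbar 0 f x = 0.
Proof. by rewrite /derbar big1 // => j _; rewrite mxE conjc0 mul0r. Qed.
Lemma derV0 (f : V -> V) x : derV 0 f x = 0.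
Proof. by apply/rowP => k; rewrite !mxE der0. Qed.
Lemma derbarV0 (f : V -> V) x : derbarV 0 f x = 0.
Proof. by apply/rowP => k; rewrite !mxE derbar0. Qed.

Variables (U : set V) (g : V -> V -> V -> C) (mul : V -> V -> V -> V).
Variables (e E : V -> V) (d : C) (nabla : V -> V -> V -> V).
Variables (kappa : V -> V -> V) (D : V -> V -> V -> V).
Hypothesis Uo : open U.
Hypothesis frob : local_frobenius U g mul e E d nabla.
Hypothesis kappa_semilinear : forall x, U x -> forall a u v,
  kappa x (a *: u + v) = a^*%C *: kappa x u + kappa x v.
Hypothesis kappa_smooth : forall u, smoothV U (fun x => kappa x u).
Hypothesis De_e : forall x, U x -> cov D e e x = 0.
Hypothesis cv : local_cv U g mul E d kappa D.
Hypothesis torsion_free : forall x u v, U x -> D x u v = D x v u.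
Hypothesis canonical : canonical_coordinates U mul.

Let nbhsU x : U x -> nbhs x U.
Proof. by move=> Ux; apply: open_nbhs_nbhs. Qed.

Let bD : bilin_field U D := chern_bilin (cv_chern cv).
Let bmul : bilin_field U mul := mul_bilin frob.

Let kappaD x u v : U x -> kappa x (u + v) = kappa x u + kappa x v.
Proof. by move=> Ux; have := kappa_semilinear Ux 1 u v; rewrite conjc1 !scale1r. Qed.

Let kappa0 x : U x -> kappa x 0 = 0.
Proof. by move=> Ux; apply: (addrI (kappa x 0)); rewrite -kappaD // !addr0. Qed.

Let kappaZ x a u : U x -> kappa x (a *: u) = a^*%C *: kappa x u.
Proof. by move=> Ux; have := kappa_semilinear Ux a u 0; rewrite kappa0 // !addr0. Qed.

Let kappaN x u : U x -> kappa x (- u) = - kappa x u.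
Proof. by move=> Ux; rewrite -scaleN1r kappaZ // rmorphN1 scaleN1r. Qed.

Lemma mul_delta x a v : U x -> mul x (eps a) v = v 0 a *: eps a.
Proof.
move=> Ux; have [/(_ (eps a)) l _] := bmul Ux.
rewrite (linear_delta v l) (bigD1 a) //= canonical // eqxx big1 ?addr0 // => b ba.
by rewrite canonical // eq_sym (negbTE ba) scaler0.
Qed.

Lemma mulE x u v k : U x -> mul x u v 0 k = u 0 k * v 0 k.
Proof.
move=> Ux; have [_ /(_ v) l] := bmul Ux.
rewrite (linear_delta u l) -[RHS](sum_delta (fun a => u 0 a * v 0 a)).
by congr (fun_of_matrix _ _ _); apply: eq_bigr => a _; rewrite mul_delta // scalerA.
Qed.

(** The operator [K_v = - kappa C_v kappa], applied to [w]. *)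
Definition conj_mul x v w := kappa x (mul x v (kappa x w)).

(** The curvature equation [D'D'' + D''D' = - (C Ct + Ct C)], evaluated on [u] of type
    (1,0) and on the conjugate of [v]; the term [D'D''] kills a constant field [w]. *)
Lemma curvature_D x u v w : U x ->
  derbarV v (fun y => D y u w) x = mul x u (conj_mul x v w) - conj_mul x v (mul x u w).
Proof.
move=> Ux; have := cv_curv cv (u, 0) (0, v) (smoothV_cst U w) Ux.
rewrite /wedge /formD' /formD'' /Defs.formC /formCt /= /opD' /opD'' /conj_op /opC.
have -> : derbarV v (fun=> w) = (fun=> 0) by apply/funext => y; rewrite derbarV_cst.
have -> : cov D (fun=> u) (fun=> w) = (fun y => D y u w).
  by apply/funext => y; rewrite cov_cst.
rewrite cov_cst (bilin_field0r _ bD) // /cov !derV0 !derbarV0 !(bilin_field0l _ bD) //.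
rewrite !(bilin_field0l _ bmul) // !(kappa0, oppr0, add0r, addr0) //.
rewrite (kappaN (mul x v _)) // (bilin_fieldNr _ _ bmul) // opprK => /oppr_inj ->.
by rewrite [kappa x (- mul x u w)]kappaN // (bilin_fieldNr _ _ bmul) // opprK.
Qed.

(** Both [D_u w] and [u o w] being symmetric in [u] and [w], so is [u o K_v w] by
    the curvature equation; set [w = e]. *)
Lemma conj_mul_is_mul x v u : U x -> conj_mul x v u = mul x u (conj_mul x v (e x)).
Proof.
move=> Ux.
have sym w : mul x u (conj_mul x v w) = mul x w (conj_mul x v u).
  have /eqP := curvature_D u v w Ux.
  have near_sym : \forall y \near x, D y u w = D y w u.
    by apply: filterS (nbhsU Ux) => y Uy; exact: torsion_free.
  rewrite (near_derbarV _ near_sym) curvature_D // (mul_comm frob w u Ux).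
  by move=> /eqP/addIr ->.
by rewrite sym (mul_unit frob).
Qed.

(** [g (eps a) v = g (eps a o eps a) v = g (eps a) (eps a o v)], and [eps a o v] is on
    the line of [eps a]. *)
Lemma metric_delta x a v : U x -> g x (eps a) v = v 0 a * g x (eps a) (eps a).
Proof.
move=> Ux.
have eaa : mul x (eps a) (eps a) = eps a by rewrite canonical // eqxx.
have [/(_ (eps a)) l _] := g_bilin frob Ux.
rewrite -{1}eaa (g_mul frob) // mul_delta // -[_ *: eps a]addr0 l.
have -> : g x (eps a) 0 = 0.
  by apply: (addrI (g x (eps a) 0)); have := l 1 0 0; rewrite !scale1r !addr0 => <-.
by rewrite addr0.
Qed.

Lemma metricE x u v : U x -> g x u v = \sum_a u 0 a * v 0 a * g x (eps a) (eps a).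
Proof.
move=> Ux; have [_ /(_ v) l] := g_bilin frob Ux.
by rewrite (linear_delta u l); apply: eq_bigr => a _; rewrite metric_delta // -mulrA.
Qed.

Lemma metric_delta_neq0 x a : U x -> g x (eps a) (eps a) != 0.
Proof.
move=> Ux; apply/eqP => g0; have : eps a = 0.
  by apply: (g_nondeg frob Ux) => v; rewrite metric_delta // g0 mulr0.
by move/rowP/(_ a); rewrite deltaE eqxx mxE => /eqP; rewrite oner_eq0.
Qed.

(** The uniqueness argument for Levi-Civita connections: [g (nabla_b c) t] is
    symmetric in [b], [c] and, the metric being constant, skew in [c], [t]. *)
Lemma nabla_eq0 : (forall x y c, U x -> U y -> g x (eps c) (eps c) = g y (eps c) (eps c)) ->
  forall x u v, U x -> nabla x u v = 0.
Proof.
move=> g_cst x u v Ux; apply: (g_nondeg frob Ux) => w.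
have lc := nabla_lc frob.
pose a b c t := g x (nabla x b c) t.
have skew b c t : a b c t = - a b t c.
  have := lc_metric lc (holomorphicV_cst U b) (holomorphicV_cst U c) (holomorphicV_cst U t) Ux.
  rewrite !cov_cst (g_sym frob c) // -/(a b c t) -/(a b t c).
  have g_near : \forall y \near x, g y c t = g x c t.
    apply: filterS (nbhsU Ux) => y Uy; rewrite !metricE //; apply: eq_bigr => k _.
    by rewrite (g_cst y x).
  by rewrite (near_der _ g_near) der_cst => /esym/eqP; rewrite addr_eq0 => /eqP.
have sym b c t : a b c t = a c b t by rewrite /a (levi_civita_sym lc).
have : a u v w = - a u v w.
  by rewrite {1}skew sym skew sym opprK skew sym.
by move/eqP; rewrite -addr_eq0 -mulr2n mulrn_eq0 => /eqP.
Qed.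

Local Notation h := (hermitian_form g kappa).

Lemma herm_delta x a c : U x ->
  h x (eps a) (eps c) = kappa x (eps c) 0 a * g x (eps a) (eps a).
Proof. by move=> Ux; rewrite /hermitian_form metric_delta. Qed.

(** Hermitian symmetry of [h] makes the support of the matrix of [kappa] symmetric. *)
Lemma kappa_delta_sym x a c : U x ->
  kappa x (eps a) 0 c != 0 -> kappa x (eps c) 0 a != 0.
Proof.
move=> Ux ka; apply: contraNneq ka => kc.
have := h_herm (cv_h cv) (eps a) (eps c) Ux; rewrite !herm_delta // kc mul0r conjc0.
by move/eqP; rewrite mulf_eq0 (negbTE (metric_delta_neq0 _ Ux)) orbF.
Qed.

(** As [K_(eps a)] is a multiplication, it maps [eps c] to a multiple of [eps c]; but
    its value there is a multiple of [kappa (eps a)], with factor the conjugate of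
    the [a]-component of [kappa (eps c)], which is nonzero. *)
Lemma kappa_delta_line x a c c' : U x -> kappa x (eps a) 0 c != 0 -> c' != c ->
  kappa x (eps a) 0 c' = 0.
Proof.
move=> Ux ka cc'.
have := congr1 (fun v : V => v 0 c') (conj_mul_is_mul (eps a) (eps c) Ux).
rewrite /conj_mul mul_delta // kappaZ // mul_delta // !mxE eqxx (negbTE cc') mulr0.
move/eqP; rewrite mulf_eq0 conjc_eq0 (negbTE (kappa_delta_sym Ux ka)) /=.
by move/eqP.
Qed.

Lemma kappa_delta_hit x c : U x -> exists a, kappa x (eps a) 0 c != 0.
Proof.
move=> Ux; apply: contrapT => /forallNP no.
have k0 : kappa x (eps c) = 0.
  apply/rowP => a; rewrite mxE; apply/eqP/negPn/negP => /(kappa_delta_sym Ux).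
  exact: no.
have := cv_kappaK cv (eps c) Ux; rewrite k0 kappa0 // => /rowP/(_ c).
by rewrite deltaE eqxx mxE => /esym/eqP; rewrite oner_eq0.
Qed.

Lemma smooth_neq0_near (f : V -> C) x : smooth U f -> U x -> f x != 0 ->
  \forall y \near x, f y != 0.
Proof.
move=> [/(_ 0)[fr _] /(_ 0)[fi _]] Ux fx0.
have rec (p : V -> R) : {for x, continuous p} -> p x != 0 -> \forall y \near x, p y != 0.
  by move=> cp px; exact: (@cvgr_neq0 _ _ _ (nbhs x) _ p (p x) cp px).
have [fr0|fr0] := eqVneq (complex.Re (f x)) 0.
  have fi0 : complex.Im (f x) != 0.
    by apply: contraNneq fx0 => fi0; rewrite eq_complex fr0 fi0 /= eqxx.
  apply: filterS (rec _ (fi x Ux) fi0) => y; apply: contraNneq => ->; exact: eqxx.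
apply: filterS (rec _ (fr x Ux) fr0) => y; apply: contraNneq => ->; exact: eqxx.
Qed.

(** Near [x] the field [kappa (eps a)] is a nonzero multiple of [eps c], for a
    suitable [a], and [D' (kappa (eps a)) = kappa (dbar (eps a)) = 0]. *)
Lemma D_delta_line x u c c' : U x -> c' != c -> D x u (eps c) 0 c' = 0.
Proof.
move=> Ux cc'; have [a kac] := kappa_delta_hit c Ux.
have := cv_D'kappa cv u (smoothV_cst U (eps a)) Ux.
rewrite /opD'' derbarV_cst kappa0 // /opD' /cov.
have -> : kappa x (eps a) = kappa x (eps a) 0 c *: eps c.
  apply/rowP => k; rewrite !mxE eqxx /=; have [->|kc] := eqVneq k c; first by rewrite mulr1.
  by rewrite mulr0 (kappa_delta_line Ux kac).
rewrite (bilin_fieldZr _ _ _ bD) // => /rowP/(_ c'); rewrite !mxE.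
have k0 : \forall y \near x, kappa y (eps a) 0 c' = 0.
  near=> y; apply: (@kappa_delta_line y a c) => //.
    by near: y; exact: nbhsU.
  by near: y; exact: (smooth_neq0_near (kappa_smooth (eps a) c) Ux kac).
rewrite (near_der _ k0) der_cst add0r => /eqP; rewrite mulf_eq0 (negbTE kac) /=.
by move/eqP.
Unshelve. all: by end_near. Qed.

Lemma D_delta_neq x a c : U x -> a != c -> D x (eps a) (eps c) = 0.
Proof.
move=> Ux ac; apply/rowP => k; rewrite mxE; have [->|kc] := eqVneq k c.
  by rewrite torsion_free // D_delta_line // eq_sym.
exact: D_delta_line.
Qed.

Lemma unit_delta x : U x -> e x = const_mx 1.
Proof.
move=> Ux; apply/rowP => a; rewrite mxE.
have := congr1 (fun v : V => v 0 a) (mul_unit frob (eps a) Ux).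
by rewrite mulE // deltaE eqxx mulr1.
Qed.

(** [D_(eps a) (eps b)] vanishes for [a != b], being on the lines of both [eps a] and
    [eps b]; then [D_e e = 0] is the sum of the [D_(eps a) (eps a)], which are on
    different lines. *)
Lemma D_eq0 x u v : U x -> D x u v = 0.
Proof.
move=> Ux.
have D_expand w z : D x w z = \sum_a w 0 a *: \sum_b z 0 b *: D x (eps a) (eps b).
  have [_ /(_ z) l] := bD Ux; rewrite (linear_delta w l); apply: eq_bigr => a _.
  by have [/(_ (eps a)) l' _] := bD Ux; rewrite (linear_delta z l').
have Dab a b : a != b -> D x (eps a) (eps b) = 0 by exact: D_delta_neq.
have Daa a : D x (eps a) (eps a) = 0.
  apply/rowP => k; rewrite [RHS]mxE; have [->|] := eqVneq k a; last exact: D_delta_line.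
  have := De_e Ux; rewrite /cov.
  have e_cst : \forall y \near x, e y = const_mx 1.
    by apply: filterS (nbhsU Ux) => y; exact: unit_delta.
  rewrite (near_derV _ e_cst) derV_cst add0r unit_delta //.
  have -> : D x (const_mx 1) (const_mx 1) = \sum_b D x (eps b) (eps b).
    rewrite D_expand; apply: eq_bigr => b _; rewrite mxE scale1r (bigD1 b) //= mxE scale1r.
    by rewrite big1 ?addr0 // => c cb; rewrite Dab 1?eq_sym // scaler0.
  move=> /rowP/(_ a); rewrite summxE (bigD1 a) //= big1 ?addr0 ?mxE // => b ba.
  by rewrite D_delta_line // eq_sym.
rewrite D_expand big1 // => a _; rewrite big1 ?scaler0 // => b _.
by have [->|ab] := eqVneq a b; rewrite ?Daa ?Dab ?scaler0.
Qed.

Lemma kappa_delta_locally_cst x r a c : polydisc x r `<=` U ->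
  forall y, polydisc x r y -> kappa y (eps a) 0 c = kappa x (eps a) 0 c.
Proof.
move=> xU; apply: (@cst_polydiscC _ _ U (fun y => kappa y (eps a) 0 c)) => //.
  exact: kappa_smooth.
move=> j y Uy; split.
  have := cv_D'kappa cv (eps j) (smoothV_cst U (eps a)) Uy.
  rewrite /opD'' derbarV_cst kappa0 // /opD' /cov D_eq0 // addr0 => /rowP/(_ c).
  by rewrite !mxE der_delta.
have := cv_D''kappa cv (eps j) (smoothV_cst U (eps a)) Uy.
rewrite /opD'' /opD' cov_cst D_eq0 // kappa0 // => /rowP/(_ c).
by rewrite !mxE derbar_delta.
Qed.

(** [h (eps c) (eps a)] is the product of a coefficient of [kappa] and of
    [g (eps c) (eps c)].  That coefficient is locally constant, so it can be scaled
    to 1 by a constant factor on [eps a]; then the holomorphic derivatives of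
    [g (eps c) (eps c)] are those of [h], which are [h (D' (eps c)) (eps a) = 0] up to
    that factor.  The antiholomorphic ones vanish because [g] is holomorphic. *)
Lemma metric_locally_cst x r c : polydisc x r `<=` U ->
  forall y, polydisc x r y -> g y (eps c) (eps c) = g x (eps c) (eps c).
Proof.
move=> xU y xy.
have xx : polydisc x r x.
  by move=> k; rewrite subrr normr0; apply: le_lt_trans (xy k).
have Ux := xU _ xx; have [a kac] := kappa_delta_hit c Ux.
set k := kappa x (eps a) 0 c in kac.
pose v := (k^-1)^*%C *: eps a.
have gh z : polydisc x r z -> g z (eps c) (eps c) = h z (eps c) v.
  move=> xz; have Uz := xU _ xz.
  rewrite (hermZr (cv_h cv)) // herm_delta // (kappa_delta_locally_cst _ _ xU) // -/k.
  by rewrite conjcK mulKf.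
apply: (@cst_polydiscC _ _ (polydisc x r) (fun z => g z (eps c) (eps c)) x r) => //.
  have [[h1 h2] _] := g_hol frob (eps c) (eps c).
  by split=> n; [exact: Ck_sub xU (h1 n) | exact: Ck_sub xU (h2 n)].
move=> j z xz; have Uz := xU _ xz; split; last by have [_ ->] := g_hol frob (eps c) (eps c).
have near_gh : \forall y \near z, g y (eps c) (eps c) = h y (eps c) v.
  have Pz : nbhs z (polydisc x r) by apply: open_nbhs_nbhs; split=> //; exact: open_polydisc.
  by apply: filterS Pz => t; exact: gh.
rewrite (near_dz _ near_gh) -der_delta (chern_der (cv_h cv) (cv_chern cv)) //.
by rewrite D_eq0 // (herm0 (cv_h cv)).
Qed.

End CanonicalChart.

(** * The potential of a constant diagonal metric *)

Section DiagonalCubic.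
Context {R : realType} {m : nat}.
Local Notation C := R[i].
Local Notation V := 'rV[C]_m.
Local Notation eps a := (delta_mx 0 a : V).

Definition diagonal_cubic (eta : 'I_m -> C) (x : V) : C :=
  \sum_a eta a / 6 * (x 0 a * x 0 a * x 0 a).

Lemma polyfun_sum (I : Type) (s : seq I) (f : I -> V -> C) :
  (forall a, polyfun (f a)) -> polyfun (fun x => \sum_(a <- s) f a x).
Proof.
move=> pf; elim: s => [|a s IH].
  by rewrite (_ : (fun x => _) = fun=> 0); [constructor | apply/funext => x; rewrite big_nil].
rewrite (_ : (fun x => _) = fun x => f a x + \sum_(b <- s) f b x); first by constructor.
by apply/funext => x; rewrite big_cons.
Qed.

Lemma has_dz_sum (I : Type) (s : seq I) j (f f' : I -> V -> C) :
  (forall a, has_dz j (f a) (f' a)) ->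
  has_dz j (fun x => \sum_(a <- s) f a x) (fun x => \sum_(a <- s) f' a x).
Proof.
move=> hf; elim: s => [|a s IH].
  have e (k : I -> V -> C) : (fun x => \sum_(a <- [::]) k a x) = (fun=> 0).
    by apply/funext => x; rewrite big_nil.
  by rewrite !e; exact: has_dz_cst.
have e (k : I -> V -> C) :
    (fun x => \sum_(b <- a :: s) k b x) = (fun x => k a x + \sum_(b <- s) k b x).
  by apply/funext => x; rewrite big_cons.
by rewrite !e; exact: has_dzD.
Qed.

Lemma has_dz_eq j (f f' g' : V -> C) : has_dz j f f' -> f' =1 g' -> has_dz j f g'.
Proof. by move=> hf /funext <-. Qed.

Lemma holomorphic_diagonal_cubic U eta : holomorphic U (diagonal_cubic eta).
Proof.
apply/polyfun_holomorphic/polyfun_sum => a.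
have pa := @polyfun_coord R m a.
exact: polyfunM (polyfun_cst _) (polyfunM (polyfunM pa pa) pa).
Qed.

Lemma dz_dz_dz_diagonal_cubic eta i j k (x : V) :
  dz i (dz j (dz k (diagonal_cubic eta))) x = if (k == j) && (k == i) then eta k else 0.
Proof.
have h1 : has_dz k (diagonal_cubic eta) (fun x => eta k / 2 * (x 0 k * x 0 k)).
  pose f' a (x : V) := if a == k then eta k / 2 * (x 0 k * x 0 k) else 0.
  rewrite (_ : (fun x => eta k / 2 * _) = (fun x => \sum_a f' a x)); last first.
    apply/funext => y; rewrite (bigD1 k) //= /f' eqxx big1 ?addr0 // => a ak.
    by rewrite (negbTE ak).
  apply: has_dz_sum => a; have ha := @has_dz_coord R m k a.
  apply: has_dz_eq (has_dzM (@has_dz_cst R m k (eta a / 6)) (has_dzM (has_dzM ha ha) ha)) _.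
  by move=> y; rewrite /f'; case: eqVneq => [->|_] /=; field.
have h2 : has_dz j (fun x : V => eta k / 2 * (x 0 k * x 0 k))
    (fun x => (k == j)%:R * eta k * x 0 k).
  have ha := @has_dz_coord R m j k.
  apply: has_dz_eq (has_dzM (@has_dz_cst R m j (eta k / 2)) (has_dzM ha ha)) _.
  by move=> y; field.
have h3 := has_dzM (@has_dz_cst R m i ((k == j)%:R * eta k)) (@has_dz_coord R m i k).
rewrite (has_dzE h1) (has_dzE h2) (has_dzE h3).
by rewrite mul0r add0r; case: eqP => _ /=; case: eqP => _ /=; rewrite ?(mul0r, mulr0, mul1r, mulr1).
Qed.

Lemma cubic_on_diagonal_cubic U eta : cubic_on U (diagonal_cubic eta).
Proof.
exists 0, (fun=> 0), (fun=> fun=> 0), (fun i j k => if (i == j) && (j == k) then eta i / 6 else 0).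
move=> x _; rewrite add0r big1 ?add0r => [|i _]; last by rewrite mul0r.
rewrite [X in _ = X + _]big1 ?add0r => [|i _]; last first.
  by rewrite big1 // => j _; rewrite !mul0r.
apply: eq_bigr => a _; rewrite (bigD1 a) //= [X in _ = _ + X]big1 ?addr0 => [|j ja]; last first.
  by rewrite big1 // => k _; rewrite eq_sym (negbTE ja) /= !mul0r.
rewrite (bigD1 a) //= [X in _ = _ + X]big1 ?addr0 => [|k ka]; last first.
  by rewrite eqxx eq_sym (negbTE ka) /= !mul0r.
by rewrite !eqxx /= !mulrA.
Qed.

End DiagonalCubic.

(** * Triviality of the Frobenius manifold *)

Section Restriction.
Context {R : realType} {m : nat} {M : topologicalType}.
Local Notation C := R[i].
Local Notation V := 'rV[C]_m.

Definition restrict_chart (p : chart R m M) (B : set V) : chart R m M :=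
  Chart (dom p `&` to p @^-1` B) (img p `&` B) (to p) (from p).

Lemma is_chart_restrict p B : is_chart p -> open B -> is_chart (restrict_chart p B).
Proof.
move=> cp Bo; split => /=.
- rewrite openE => q [dq Bq]; apply: filterI.
    exact: open_nbhs_nbhs (conj (dom_open cp) dq).
  by apply: (to_cont cp dq); apply: open_nbhs_nbhs.
- by apply: openI => //; exact: img_open.
- by move=> q [dq Bq]; split=> //; exact: to_img.
- by move=> x [ix Bx]; split; [exact: from_dom | rewrite /preimage /= (fromK cp)].
- by move=> q [dq _]; exact: toK.
- by move=> x [ix _]; exact: fromK.
- by move=> q [dq _]; exact: to_cont.
- by move=> x [ix _]; exact: from_cont.
Qed.

Lemma atlas_restrict (A : complex_manifold R m M) p B :
  atlas A p -> open B -> atlas A (restrict_chart p B).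
Proof.
move=> Ap Bo; apply: atlas_maximal.
  by apply: is_chart_restrict => //; exact: atlas_chart Ap.
move=> p' Ap'; have [h1 h2] := atlas_compatible Ap Ap'; split.
  by apply: holomorphicV_sub h1 => x [[ix _] dx]; split.
by apply: holomorphicV_sub h2 => x [ix [dx _]]; split.
Qed.

Context {A : complex_manifold R m M}.

(** The transition map is the identity, so the tensors are unchanged. *)
Lemma restrict_transition (F : frobenius_manifold A) p B x : atlas A p -> open B ->
  img p x -> B x ->
  (forall u v, fm_g F (restrict_chart p B) x u v = fm_g F p x u v) /\
  (forall u v, fm_mul F (restrict_chart p B) x u v = fm_mul F p x u v).
Proof.
move=> Ap Bo ix Bx.
have cp := atlas_chart Ap.
have ov : overlap p (restrict_chart p B) x.
  by split=> //; split; [exact: from_dom | rewrite /preimage /= (fromK cp)].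
have tid : \forall y \near x, transition p (restrict_chart p B) y = id y.
  apply: filterS (open_nbhs_nbhs (conj (img_open cp) ix)) => y iy.
  by rewrite /transition /= (fromK cp).
have pid u : push p (restrict_chart p B) x u = u.
  by rewrite /push (near_derV _ tid) derV_id.
have [hg hm _ _] := fm_transition F Ap (atlas_restrict Ap Bo) ov.
move: hg hm; rewrite (nbhs_singleton tid) /= => hg hm.
by split=> u v; [rewrite -hg !pid | rewrite -[RHS]pid -hm !pid].
Qed.

(** The chart must be restricted to a polydisc: its image may be disconnected, and
    the coefficients of a cubic potential are the same everywhere. *)
Lemma torsion_free_trivial (F : frobenius_manifold A) (S : cdv_structure F) :
  semisimple F ->
  (forall p, atlas A p -> forall x u v, img p x -> cdv_D' S p x u v = cdv_D' S p x v u) ->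
  trivial_frobenius F.
Proof.
move=> ss tf q; have [p [Ap dq can]] := ss q.
have cp := atlas_chart Ap.
pose x0 := to p q; have ix0 : img p x0 by exact: to_img.
have := open_nbhs_nbhs (conj (img_open cp) ix0).
move=> /nbhs_polydisc[r r0 xU]; pose B := polydisc x0 r.
have Bo : open B by exact: open_polydisc.
have Ap' := atlas_restrict Ap Bo; set p' := restrict_chart p B in Ap'.
have g_cst := metric_locally_cst (img_open cp) (fm_local F Ap) (cdv_semilinear S Ap)
  (cdv_smooth S Ap) (cdv_De_e S Ap) (cdv_cv S Ap) (tf p Ap) can _ xU.
have can' : canonical_coordinates (img p') (fm_mul F p').
  move=> a b x [ix Bx]; have [_ ->] := restrict_transition F Ap Bo ix Bx; exact: can.
have frob' := fm_local F Ap'.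
pose eta a := fm_g F p x0 (delta_mx 0 a) (delta_mx 0 a).
have g_eta x a : img p' x -> fm_g F p' x (delta_mx 0 a) (delta_mx 0 a) = eta a.
  by move=> [ix Bx]; have [-> _] := restrict_transition F Ap Bo ix Bx; exact: g_cst.
exists p', (diagonal_cubic eta); split => //.
- by split=> //; exact: polydisc_center.
- move=> i X hX x ix; rewrite cov_cst; apply: (nabla_eq0 _ frob') => //.
    exact: img_open (atlas_chart Ap').
  by move=> y z c iy iz; rewrite !g_eta.
- split; first exact: holomorphic_diagonal_cubic.
  move=> i j k x ix; rewrite dz_dz_dz_diagonal_cubic can' //.
  have := metricE frob' can'; case: (eqVneq i j) => [<-|ij].
    rewrite andbb => gE; rewrite gE // (bigD1 i) //= !mxE !eqxx /= big1 ?addr0.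
      by rewrite g_eta // mul1r eq_sym; case: eqP => [->|]; rewrite ?mul1r ?mul0r.
    by move=> a ai; rewrite !mxE eqxx (negbTE ai) !mul0r.
  move=> gE; rewrite gE // big1 ?mxE => [|a _]; last by rewrite mxE !mul0r.
  by case: eqP => // ->; rewrite eq_sym (negbTE ij).
- exact: cubic_on_diagonal_cubic.
Qed.

End Restriction.

(** * The theorem *)

Theorem theorem2p10 (R : realType) (m : nat) (M : topologicalType)
    (A : complex_manifold R m M) (F : frobenius_manifold A)
    (S : cdv_structure F)
    (nablahat : chart R m M -> 'rV[R[i]]_m ->
       realvec R m -> realvec R m -> realvec R m)
    (Hsemisimple : semisimple F)
    (Hnontrivial : ~ trivial_frobenius F)
    (Hnablahat : is_levi_civita_ghat S nablahat) :
  (~ symplectic_omegahat S /\ (cdv_plus S -> ~ kahler S)) /\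
  [/\ ~ coincide10 A (fm_nabla F) (cdv_D' S),
      ~ coincide_via_Re A (fm_nabla F) nablahat &
      ~ coincide_via_Re A (cdv_D' S) nablahat].
Proof.
have torsion : ~ (forall p, atlas A p -> forall x u v, img p x ->
    cdv_D' S p x u v = cdv_D' S p x v u).
  by move=> tf; apply/Hnontrivial/(torsion_free_trivial (S := S)).
have nabla_neq_D' : ~ (forall p, atlas A p -> forall x u v, img p x ->
    fm_nabla F p x u v = cdv_D' S p x u v).
  move=> eqD; apply: torsion => p Ap x u v ix; rewrite -!eqD //.
  exact: levi_civita_sym (nabla_lc (fm_local F Ap)) _ _ _ ix.
have coincide_cst G : coincide_via_Re A G nablahat -> forall p, atlas A p ->
    forall x u v, img p x -> toRe (G p x u v) = nablahat p x (toRe u) (toRe v).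
  move=> GRe p Ap x u v ix.
  have := GRe p Ap _ _ (holomorphicV_cst _ v) (rsmoothV_cst _ (toRe u)) x ix.
  by rewrite rcov_cst cov_cst toReK.
have not_symplectic : ~ symplectic_omegahat S.
  move=> closed; apply: torsion => p Ap x u v ix.
  apply: (closed_torsion_free (img_open (atlas_chart Ap)) (cv_h (cdv_cv S Ap))
    (cv_chern (cdv_cv S Ap))) => // {u v ix}x X Y Z ix.
  by apply: closed => //; exact: rsmoothV_cst.
split; first by split=> // _ [].
split.
- move=> eqD; apply: nabla_neq_D' => p Ap x u v ix.
  have := eqD p Ap _ _ (smoothV_cst _ u) (smoothV_cst _ v) x ix.
  by rewrite !cov_cst.
- move=> /coincide_cst eqRe; apply: nabla_neq_D' => p Ap.
  apply: (metric_10_unique (cv_h (cdv_cv S Ap)) (cv_chern (cdv_cv S Ap))).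
    exact: lc_bilin (nabla_lc (fm_local F Ap)).
  move=> x u v w ix.
  have := rlc_metric (Hnablahat p Ap) (rsmoothV_cst _ (toRe u)) (rsmoothV_cst _ (toRe v))
    (rsmoothV_cst _ (toRe w)) ix.
  by rewrite !rcov_cst -!eqRe // /ghat /cdv_h !toReK raddfD.
- move=> /coincide_cst eqRe; apply: torsion => p Ap x u v ix.
  apply: (can_inj toReK); rewrite !eqRe //.
  exact: real_levi_civita_sym (Hnablahat p Ap) _ _ _ ix.
Qed.
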